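(* Let $d\ge 3$ and $x\in\mathbb{R}^d$ be given, and let $B(t)$, $t\ge0$, be the Brownian motion in $\mathbb{R}^d$ on a probability space $(\Omega,P)$, starting from $x$, with generator the Laplace operator $\Delta$. Let $CL(\mathbb{R}^d)=C_b(\mathbb{R}^d)\cap L^1(\mathbb{R}^d)$ with norm $\|f\|_{CL}=\sup|f|+\|f\|_{L^1(\mathbb{R}^d)}$, and put $Y(f)=\int_0^\infty f(B(t))\,\mathrm{d}t$. Then the mapping $$Y: CL(\mathbb{R}^d)\to L^1(\Omega,P)$$ is a continuous linear operator, and it has a unique representation $$Y(f)(\omega)=\int_{\mathbb{R}^d}f(y)\,\mu^x(\mathrm{d}y,\omega)\qquad\text{for all } f\in CL(\mathbb{R}^d)$$ (equality of elements of $L^1(\Omega,P)$), where $\mu^x(\mathrm{d}y,\omega)$ is an $L^1(\Omega,P)$-valued Radon measure on $\mathcal{B}_b(\mathbb{R}^d)$ which is $\sigma$-additive in the strong (norm) topology of $L^1(\Omega,P)$.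
   Context: $C_b(\mathbb{R}^d)$ is the space of bounded continuous real functions on $\mathbb{R}^d$; $\mathcal{B}_b(\mathbb{R}^d)$ is the family of bounded Borel subsets of $\mathbb{R}^d$. The random variable $Y(f)=\int_0^\infty f(B(t))\,\mathrm{d}t$ is understood as the limit in $L^1(\Omega,P)$, as $T\to\infty$, of $\int_0^T f(B(t))\,\mathrm{d}t$. A vector valued Radon measure means here a set function $\mu:\mathcal{B}_b(\mathbb{R}^d)\to L^1(\Omega,P)$, defined (finite) on every bounded Borel set; $\sigma$-additive in the strong topology means that $\mu(\bigcup_n A_n)=\sum_n\mu(A_n)$ with convergence in $L^1(\Omega,P)$-norm whenever the $A_n\in\mathcal{B}_b(\mathbb{R}^d)$ are pairwise disjoint with $\bigcup_nA_n\in\mathcal{B}_b(\mathbb{R}^d)$. The value $\mu(A)\in L^1(\Omega,P)$ is written $\mu(A,\omega)$. For $f\in CL(\mathbb{R}^d)$, the integral over a ball $B_N(0)=\{|y|\le N\}$ is the usual integral of a bounded Borel function with respect to a vector measure (extension from simple functions by uniform limits), and the integral over $\mathbb{R}^d$ is the $L^1(\Omega,P)$-limit as $N\to\infty$ of the integrals over $B_N(0)$. Uniqueness refers to the measure $\mu^x$. *)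

(* Defs.v *)
From HB Require Import structures.
From mathcomp Require Import all_boot all_order all_algebra generic_quotient.
From mathcomp Require Import all_classical all_reals all_analysis.
From mathcomp Require Import measurable_realfun lra.
Set Implicit Arguments.
Unset Strict Implicit.
Unset Printing Implicit Defensive.
Import Order.TTheory GRing.Theory Num.Theory.
Import numFieldNormedType.Exports.
Local Open Scope classical_set_scope.
Local Open Scope ring_scope.

(* The library's space of a.e.-classes of integrable functions, on which the
   normed space structure is built below. *)
Definition L1 d (T : measurableType d) (R : realType)
  (mu : {measure set T -> \bar R}) : Type := LspaceType1 mu.

Section L1_normed.
Context d (T : measurableType d) (R : realType).
Context (mu : {measure set T -> \bar R}).
Local Notation M := {mfun_ mu, T >-> measurableTypeR R}.
Local Notation Lf := (LfunType mu (@lexx _ (\bar R) 1%E)).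
Implicit Types (u v w : L1 mu) (f g : Lf) (a b : R).

(* an arbitrary representative of the class *)
Definition L1_fun u : T -> R := (u : LspaceType1 mu) : M.
Coercion L1_fun : L1 >-> Funclass.

Lemma measurable_L1_fun u : measurable_fun [set: T] u.
Proof. exact: (@measurable_funPT _ _ _ _ (repr (LebesgueSpace.sort u : M))). Qed.

Lemma finite_norm_L1_fun u : finite_norm mu 1 u.
Proof. exact: (@Lebesgue_finite _ _ _ _ _ _ u). Qed.

Lemma L1_fun_Lfun u : (u : T -> R) \in Lfun mu 1.
Proof.
apply/andP; split; rewrite inE/=; first exact: measurable_L1_fun.
exact: finite_norm_L1_fun.
Qed.

Definition L1_repr u : Lf := Lfun_Sub _ (L1_fun_Lfun u).

Local Open Scope quotient_scope.

Let m2m (f : {mfun T >-> R}) : {mfun T >-> measurableTypeR R} :=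
  MeasurableFun.Pack (MeasurableFun.Class (@isMeasurableFun.Build _ _ T
    (measurableTypeR R) f (@measurable_funPT _ _ _ _ f))).

Let cls f : M := \pi_M (m2m f).

Let clsE f : (cls f : T -> R) = f %[ae mu].
Proof.
rewrite /cls /aqEqMfun_to_fun; case: piP => g /eqP.
by rewrite eqmodE => /asboolP fg; exact: ae_eq_sym.
Qed.

Let ae_eq_Lnorm1 (f g : T -> R) : measurable_fun [set: T] f ->
  measurable_fun [set: T] g ->
  f = g %[ae mu] -> ('N[mu]_1[EFin \o f] = 'N[mu]_1[EFin \o g])%E.
Proof.
move=> mf mg fg; rewrite !Lnorm1; apply: ae_eq_integral => //.
- by apply: (measurableT_comp (@abse_measurable R setT)); exact/measurable_EFinP.
- by apply: (measurableT_comp (@abse_measurable R setT)); exact/measurable_EFinP.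
- apply: ae_eq_abse; exact: (ae_eq_comp EFin fg).
Qed.

Let cls_finite f : finite_norm mu 1 (cls f).
Proof.
rewrite /finite_norm (ae_eq_Lnorm1 _ _ (clsE f))//; last first.
- exact: (@measurable_funPT _ _ _ _ (repr (cls f))).
- exact: (@Lfunction_finite _ _ _ mu 1%E _ f).
Qed.

Definition L1_class f : L1 mu :=
  LebesgueSpace.Pack
    (LebesgueSpace.Class
      (@isFinLebesgue.Build d T R mu 1%E (@lexx _ (\bar R) 1%E)
        (cls f) (cls_finite f))).

Lemma L1_classE f : (L1_class f : T -> R) = f %[ae mu].
Proof. exact: clsE. Qed.

Lemma L1P u v : (u : T -> R) = v %[ae mu] <-> u = v.
Proof.
split=> [|->]; last exact: ae_eq_refl.
case: u v => [u [[hu]]] [v [[hv]]] uv.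
have uvE : u = v.
  rewrite -[u]reprK -[v]reprK; apply/eqP; rewrite eqmodE.
  exact/asboolP.
by subst v; rewrite (bool_irrelevance hu hv).
Qed.

HB.instance Definition _ := gen_eqMixin (L1 mu).
HB.instance Definition _ := gen_choiceMixin (L1 mu).

Let add u v := L1_class (L1_repr u + L1_repr v).
Let opp u := L1_class (- L1_repr u).
Let zero := L1_class 0.
Let scale a u := L1_class (a *: L1_repr u).
Let norm u := fine ('N[mu]_1[EFin \o u])%E.

Lemma L1_reprK u : L1_class (L1_repr u) = u.
Proof. by apply/L1P; exact: L1_classE. Qed.

Lemma eq_L1_class f g : (f : T -> R) = g %[ae mu] -> L1_class f = L1_class g.
Proof.
move=> fg; apply/L1P; apply: ae_eq_trans (L1_classE f) _.
by apply: ae_eq_trans fg _; exact/ae_eq_sym/L1_classE.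
Qed.

Let classD f g : add (L1_class f) (L1_class g) = L1_class (f + g).
Proof.
apply: eq_L1_class; have := L1_classE f; have := L1_classE g.
by apply: filterS2 => t hg hf tT; exact: (congr2 +%R (hf tT) (hg tT)).
Qed.

Let classN f : opp (L1_class f) = L1_class (- f).
Proof.
apply: eq_L1_class; have := L1_classE f.
by apply: filterS => t hf tT; exact: (congr1 -%R (hf tT)).
Qed.

Let classZ a f : scale a (L1_class f) = L1_class (a *: f).
Proof.
apply: eq_L1_class; have := L1_classE f.
by apply: filterS => t hf tT; exact: (congr1 ( *%R a) (hf tT)).
Qed.

Let addA : associative add.
Proof.
move=> u v w; rewrite -(L1_reprK u) -(L1_reprK v) -(L1_reprK w).
by rewrite !classD addrA.
Qed.

Let addC : commutative add.
Proof. by move=> u v; rewrite -(L1_reprK u) -(L1_reprK v) !classD addrC. Qed.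

Let add0 : left_id zero add.
Proof. by move=> u; rewrite -(L1_reprK u) classD add0r. Qed.

Let addN : left_inverse zero opp add.
Proof. by move=> u; rewrite -(L1_reprK u) classN classD addNr. Qed.

HB.instance Definition _ := GRing.isZmodule.Build (L1 mu) addA addC add0 addN.

Let scaleA a b u : scale a (scale b u) = scale (a * b) u.
Proof. by rewrite -(L1_reprK u) !classZ scalerA. Qed.

Let scale1 : left_id 1 scale.
Proof. by move=> u; rewrite -(L1_reprK u) classZ scale1r. Qed.

Let scaleDr : right_distributive scale +%R.
Proof.
move=> a u v; rewrite -(L1_reprK u) -(L1_reprK v).
by rewrite [_ + _]classD !classZ [RHS]classD scalerDr.
Qed.

Let scaleDl u : {morph scale^~ u : a b / a + b}.
Proof.
by move=> a b; rewrite -(L1_reprK u) !classZ [RHS]classD scalerDl.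
Qed.

HB.instance Definition _ :=
  GRing.Zmodule_isLmodule.Build R (L1 mu) scaleA scale1 scaleDr scaleDl.

Lemma L1_funD u v : ((u + v : L1 mu) : T -> R) = (fun t => u t + v t) %[ae mu].
Proof. exact: L1_classE. Qed.

Lemma L1_funN u : ((- u : L1 mu) : T -> R) = (fun t => - u t) %[ae mu].
Proof. exact: L1_classE. Qed.

Lemma L1_funZ a u : ((a *: u : L1 mu) : T -> R) = (fun t => a * u t) %[ae mu].
Proof. exact: L1_classE. Qed.

Lemma L1_fun0 : ((0 : L1 mu) : T -> R) = (fun=> 0) %[ae mu].
Proof. exact: L1_classE. Qed.

Let norm_class f : norm (L1_class f) = fine ('N[mu]_1[EFin \o f])%E.
Proof.
congr fine; apply: ae_eq_Lnorm1 (L1_classE f) => //.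
exact: measurable_L1_fun.
Qed.

Let normD u v : norm (u + v) <= norm u + norm v.
Proof.
rewrite -(L1_reprK u) -(L1_reprK v) [_ + _ in leLHS]classD !norm_class.
exact: ler_LnormD.
Qed.

Let normZ a u : norm (a *: u) = `|a| * norm u.
Proof.
rewrite -(L1_reprK u) [a *: _]classZ !norm_class.
have := LnormZ (L1_repr u) a.
rewrite -(finite_norm_fine (L1_repr u)) -EFinM => /(congr1 fine)/= <-//.
Qed.

Let norm0_eq0 u : norm u = 0 -> u = 0.
Proof.
rewrite -(L1_reprK u) norm_class => /fine_Lnormr_eq0 u0.
by apply: eq_L1_class.
Qed.

HB.instance Definition _ :=
  Lmodule_isNormed.Build R (L1 mu) normD normZ norm0_eq0.

Lemma L1_normE u : `|u| = fine ('N[mu]_1[EFin \o u])%E.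
Proof. by []. Qed.

End L1_normed.
Section borel_matrix.
Context (R : realType) (m n : nat).

Local Notation borel := <<s @open 'M[R]_(m, n) >>.

Let borel0 : borel set0. Proof. exact: sigma_algebra0. Qed.

Let borelC A : borel A -> borel (~` A). Proof. exact: sigma_algebraC. Qed.

Let borel_bigcup (F : (set 'M[R]_(m, n))^nat) :
  (forall i, borel (F i)) -> borel (\bigcup_i F i).
Proof. exact: sigma_algebra_bigcup. Qed.

(* matrices, hence the row vectors 'rV[R]_d standing for R^d, carry their
   Borel sigma-algebra *)
HB.instance Definition _ := @isMeasurable.Build
  default_measure_display 'M[R]_(m, n) borel
  borel0 borelC borel_bigcup.

Lemma open_measurable_mx (U : set 'M[R]_(m, n)) : open U -> measurable U.
Proof. exact: sub_sigma_algebra. Qed.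

Lemma continuous_measurable_mx (f : 'M[R]_(m, n) -> R) :
  continuous f -> measurable_fun [set: 'M[R]_(m, n)] f.
Proof.
move=> /continuousP cf; apply: (measurability _ (RGenOpens.measurableE R)).
move=> _ [_ [a [b ->] <-]]; rewrite setTI.
apply: open_measurable_mx; apply: cf; exact: interval_open.
Qed.

End borel_matrix.

Section lebesgue_rV.
Context (R : realType).

Section lebesgue_step.
Context (n : nat).

Definition cons_rV (p : R * 'rV[R]_n) : 'rV[R]_n.+1 :=
  \row_i oapp (p.2 ord0) p.1 (unlift ord0 i).
Definition uncons_rV (v : 'rV[R]_n.+1) : R * 'rV[R]_n :=
  (v ord0 ord0, \row_j v ord0 (lift ord0 j)).

Lemma cons_rVK : cancel cons_rV uncons_rV.
Proof.
move=> [a v]; rewrite /uncons_rV /cons_rV mxE unlift_none/=; congr pair.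
by apply/rowP => j; rewrite !mxE liftK.
Qed.

Lemma measurable_cons_rV : measurable_fun [set: R * 'rV[R]_n] cons_rV.
Proof.
apply: (measurability (@open 'rV[R]_n.+1)) => // _ [U oU <-]; rewrite setTI.
pose box (t : rat * 'rV[rat]_n * nat) : set (R * 'rV[R]_n) :=
  ball (ratr t.1.1 : R) t.2.+1%:R^-1 `*`
  ball (map_mx ratr t.1.2 : 'rV[R]_n) t.2.+1%:R^-1.
have mbox t : measurable (box t).
  apply: measurableX.
    by apply: open_measurable; exact: ball_open.
  by apply: open_measurable_mx; exact: ball_open.
pose F k := if unpickle k is Some t then
  if `[< box t `<=` cons_rV @^-1` U >] then box t else set0 else set0.
suff -> : cons_rV @^-1` U = \bigcup_k F k.
  apply: bigcup_measurable => k _; rewrite /F; case: unpickle => // t.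
  by case: ifP.
apply/seteqP; split=> [[a v] Uav|p [k _]]; last first.
  by rewrite /F; case: unpickle => // t; case: ifPn => // /asboolP; exact.
have /nbhs_ballP[e/= e0 eU] : nbhs (cons_rV (a, v)) U by exact: open_nbhs_nbhs.
pose k := (Num.truncn (2 / e)).
have k0 : 0 < k.+1%:R^-1 :> R by rewrite invr_gt0.
have ke : k.+1%:R^-1 + k.+1%:R^-1 < e :> R.
  suff : k.+1%:R^-1 < e / 2 by move: (_^-1) => y; lra.
  rewrite -[X in _ < X]invrK invfM invrK.
  by rewrite ltf_pV2 ?posrE ?mulr_gt0 ?invr_gt0// mulrC truncnS_gt.
have rd (x : R) : {q : rat | ball (ratr q : R) k.+1%:R^-1 x}.
  apply: cid; have /rat_in_itvoo[q] : x - k.+1%:R^-1 < x + k.+1%:R^-1.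
    by move: (_^-1) k0 => y; lra.
  rewrite in_itv/= => /andP[q1 q2]; exists q; rewrite /ball/= ltr_norml.
  by move: (_^-1) q1 q2 => y; lra.
suff [t boxt tU] : exists2 t, box t (a, v) & box t `<=` cons_rV @^-1` U.
  by exists (pickle t); [exact: I | rewrite /F pickleK; case: asboolP].
exists (sval (rd a), \row_j sval (rd (v ord0 j)), k).
  split; rewrite /=; first exact: (svalP (rd a)).
  by split => // i j; rewrite [i]ord1 !mxE; exact: (svalP (rd (v ord0 j))).
move=> [b w] [/= tb [_ tw]].
apply: eU; split => // i j; rewrite ord1 !mxE.
apply: (le_ball (ltW ke)).
case: (unliftP ord0 j) => [l _|_] /=.
  apply: ball_triangle (tw ord0 l); apply: ball_sym.
  by rewrite !mxE; exact: (svalP (rd (v ord0 l))).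
by apply: ball_triangle tb; apply: ball_sym; exact: (svalP (rd a)).
Qed.

Lemma measurable_uncons_rV : measurable_fun [set: 'rV[R]_n.+1] uncons_rV.
Proof.
apply: measurable_fun_pair => /=.
  by apply: continuous_measurable_mx; exact: coord_continuous.
apply: (measurability (@open 'rV[R]_n)) => // _ [U oU <-]; rewrite setTI.
apply: open_measurable_mx; move: oU; rewrite !openE => oU v /= /oU.
move=> /nbhs_ballP[e/= e0 eU]; apply/nbhs_ballP; exists e => //= w [_ vw].
by apply: eU; split => // i j; rewrite !mxE; exact: vw.
Qed.

Context (m : {sigma_finite_measure set 'rV[R]_n -> \bar R}).

Definition lebesgue_cons : set 'rV[R]_n.+1 -> \bar R :=
  pushforward (@lebesgue_measure R \x m)%E cons_rV.

Let lebesgue_cons0 : lebesgue_cons set0 = 0%E.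
Proof. by rewrite /lebesgue_cons /pushforward preimage_set0 measure0. Qed.

Let lebesgue_cons_ge0 A : (0 <= lebesgue_cons A)%E.
Proof. exact: (measure_ge0 (@lebesgue_measure R \x m)%E). Qed.

Let measurable_preimage_cons_rV (A : set 'rV[R]_n.+1) :
  measurable A -> measurable (cons_rV @^-1` A).
Proof. by move=> mA; rewrite -[X in measurable X]setTI; exact: measurable_cons_rV. Qed.

Let lebesgue_cons_sigma_additive : semi_sigma_additive lebesgue_cons.
Proof.
move=> F mF tF mUF; rewrite /lebesgue_cons /pushforward preimage_bigcup.
apply: (@measure_semi_sigma_additive _ _ _ (@lebesgue_measure R \x m)%E).
- by move=> i; exact: measurable_preimage_cons_rV.
- apply/trivIsetP => /= i j _ _ ij; rewrite -preimage_setI.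
  by move/trivIsetP : tF => /(_ _ _ _ _ ij) ->//; rewrite preimage_set0.
- by rewrite -preimage_bigcup; exact: measurable_preimage_cons_rV.
Qed.

HB.instance Definition _ := isMeasure.Build _ _ _ lebesgue_cons
  lebesgue_cons0 lebesgue_cons_ge0 lebesgue_cons_sigma_additive.

Let lebesgue_cons_sigma_finite : sigma_finite setT lebesgue_cons.
Proof.
have /sigma_finiteP[F [TF ndF Foo]] := sigma_finiteT (@lebesgue_measure R).
have /sigma_finiteP[G [TG ndG Goo]] := sigma_finiteT m.
exists (fun k => uncons_rV @^-1` (F k `*` G k)) => [|k].
  apply/esym/seteqP; split => // v _.
  have [k1 _ Fv] : (\bigcup_i F i) (uncons_rV v).1 by rewrite -TF.
  have [k2 _ Gv] : (\bigcup_i G i) (uncons_rV v).2 by rewrite -TG.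
  exists (maxn k1 k2) => //; split.
    by move: Fv; exact/subsetPset/ndF/leq_maxl.
  by move: Gv; exact/subsetPset/ndG/leq_maxr.
have [mF Fk] := Foo k; have [mG Gk] := Goo k; split.
  rewrite -[X in measurable X]setTI; apply: measurable_uncons_rV => //.
  exact: measurableX.
rewrite /lebesgue_cons /pushforward -comp_preimage (_ : _ \o _ = id); last first.
  by apply/funext => p /=; rewrite cons_rVK.
by rewrite product_measure1E// lte_mul_pinfty// ge0_fin_numE.
Qed.

HB.instance Definition _ := Measure_isSigmaFinite.Build _ _ _ lebesgue_cons
  lebesgue_cons_sigma_finite.

End lebesgue_step.

(* n-fold product of the one-dimensional Lebesgue measure; lebesgue_rV_itv
   below gives its value on boxes *)
Fixpoint lebesgue_rV n : {sigma_finite_measure set 'rV[R]_n -> \bar R} :=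
  if n is n'.+1 then lebesgue_cons (lebesgue_rV n') else \d_(0 : 'rV[R]_0).

Lemma lebesgue_rV0 : lebesgue_rV 0 = \d_(0 : 'rV[R]_0) :> (set _ -> _).
Proof. by []. Qed.

Lemma lebesgue_rVS n : lebesgue_rV n.+1 =
  pushforward (@lebesgue_measure R \x lebesgue_rV n)%E (@cons_rV n)
  :> (set _ -> _).
Proof. by []. Qed.

Lemma lebesgue_rV_itv n (a b : 'I_n -> R) : (forall i, a i <= b i) ->
  lebesgue_rV n [set v | forall i, v ord0 i \in `[a i, b i]] =
  (\prod_(i < n) (b i - a i))%:E.
Proof.
elim: n a b => [|n IH] a b ab.
  rewrite big_ord0 lebesgue_rV0 diracE mem_set//= => -[]//.
rewrite lebesgue_rVS /pushforward big_ord_recl EFinM -IH//.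
pose B := [set v : 'rV[R]_n |
  forall i, v ord0 i \in `[a (lift ord0 i), b (lift ord0 i)]].
transitivity
  ((@lebesgue_measure R \x lebesgue_rV n)%E (`[a ord0, b ord0] `*` B)).
  congr (product_measure1 _ _ _).
  apply/seteqP; split=> [[t v] /= H|[t v] /= [H1 H2] i].
    split; first by have := H ord0; rewrite mxE unlift_none.
    by move=> i; have := H (lift ord0 i); rewrite mxE liftK.
  by rewrite mxE; case: unliftP => [j|] -> //=.
rewrite product_measure1E//; last first.
  rewrite (_ : B = \bigcap_(i in [set: 'I_n]) [set v : 'rV[R]_n |
      v ord0 i \in `[a (lift ord0 i), b (lift ord0 i)]]); last first.
    by apply/seteqP; split=> [v H i _|v H i]; [exact: H | exact: (H i I)].
  apply: fin_bigcap_measurable => // i _.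
  have mv := continuous_measurable_mx (@coord_continuous R 1 n ord0 i).
  rewrite -[X in measurable X]setTI.
  exact: (mv measurableT `[a (lift ord0 i), b (lift ord0 i)]%classic
    (measurable_itv _)).
have len : @lebesgue_measure R `[a ord0, b ord0]%classic = (b ord0 - a ord0)%:E.
  rewrite lebesgue_measure_itv/= lte_fin.
  by have := ab ord0; rewrite le_eqVlt => /predU1P[->|->]//; rewrite ltxx subrr.
by rewrite [X in (X * _)%E]len.
Qed.

End lebesgue_rV.

Section CL.
Context (R : realType) (d : nat).
Local Notation E := 'rV[R]_d.
Local Notation leb := (@lebesgue_rV R d).

Definition CL_pred : {pred E -> R} := mem [set f : E -> R |
  [/\ continuous f, bounded_fun f & leb.-integrable [set: E] (EFin \o f)]].

Definition CL_key : pred_key CL_pred. Proof. exact. Qed.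
Canonical CL_keyed := KeyedPred CL_key.

Record CL := MkCL { CL_fun :> E -> R ; CL_funP : CL_fun \in CL_pred }.

HB.instance Definition _ := [isSub for CL_fun].
HB.instance Definition _ := [Choice of CL by <:].

Lemma CL_continuous (f : CL) : continuous f.
Proof. by have := CL_funP f; rewrite inE => -[]. Qed.

Lemma CL_bounded (f : CL) : bounded_fun f.
Proof. by have := CL_funP f; rewrite inE => -[]. Qed.

Lemma CL_integrable (f : CL) : leb.-integrable [set: E] (EFin \o f).
Proof. by have := CL_funP f; rewrite inE => -[]. Qed.

Let bounded_funZ (a : R) (f : E -> R) : bounded_fun f -> bounded_fun (a *: f).
Proof.
move=> [M [Mr fM]]; exists (`|a| * (`|M| + 1)); split; first exact: num_real.
move=> x ax y _; apply: le_trans (ltW ax); rewrite [_ y]/(a * f y) normrM.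
apply: ler_wpM2l => //; apply: fM => //.
by rewrite (le_lt_trans (ler_norm M))// ltrDl.
Qed.

Lemma CL_submod_closed : submod_closed CL_pred.
Proof.
split.
  rewrite inE; split.
  - by move=> y; exact: cst_continuous.
  - by exists 0; split=> // x x0 y _ /=; rewrite normr0 ltW.
  - exact: integrable0.
move=> a f g; rewrite !inE => -[cf bf lf] [cg bg lg]; split.
- move=> y; apply: (@continuousD _ _ _ (a *: f) g); last exact: cg.
  by apply: continuousM => //; [exact: cst_continuous|exact: cf].
- by apply: bounded_funD bg; exact: bounded_funZ.
- apply: (eq_integrable _ (fun y => a%:E * (f y)%:E + (g y)%:E)%E) => //.
  by apply: integrableD => //; exact: integrableZl.
Qed.

HB.instance Definition _ := GRing.isSubmodClosed.Build _ _ CL_pred CL_submod_closed.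
HB.instance Definition _ := [SubChoice_isSubLmodule of CL by <:].

Definition CL_norm (f : CL) : R :=
  sup (range (fun y => `|f y|)) + \int[leb]_y `|f y|.

Let has_ub (f : CL) : has_ubound (range (fun y => `|f y|)).
Proof.
have [M [Mr fM]] := CL_bounded f.
exists (`|M| + 1) => _ [y _ <-]; apply: fM => //.
by rewrite (le_lt_trans (ler_norm M))// ltrDl.
Qed.

Let le_supf (f : CL) y : `|f y| <= sup (range (fun y => `|f y|)).
Proof. by apply: ub_le_sup; [exact: has_ub|exists y]. Qed.

Let range0 (f : CL) : range (fun y => `|f y|) !=set0.
Proof. by exists `|f 0|; exists 0. Qed.

Let integrable_normf (f : CL) :
  leb.-integrable setT (EFin \o (fun y => `|f y|)).
Proof. exact: integrable_norm (CL_integrable f). Qed.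

Let CL_normD f g : CL_norm (f + g) <= CL_norm f + CL_norm g.
Proof.
rewrite /CL_norm addrACA lerD//.
  apply: ge_sup => // _ [y _ <-]; apply: le_trans (ler_normD _ _) _.
  by rewrite lerD.
rewrite -RintegralD//; apply: le_Rintegral => //.
  exact: (integrableD _ (integrable_normf f) (integrable_normf g)).
by move=> y _; exact: ler_normD.
Qed.

Let CL_normZ a f : CL_norm (a *: f) = `|a| * CL_norm f.
Proof.
have sup_le b (g : CL) :
    sup (range (fun y => `|(b *: g : CL) y|)) <= `|b| * sup (range (fun y => `|g y|)).
  apply: ge_sup => // _ [y _ <-].
  by rewrite [X in `|X|]/(b * g y) normrM ler_wpM2l.
rewrite /CL_norm mulrDr; congr (_ + _).
  apply/eqP; rewrite eq_le sup_le/=.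
  have [->|a0] := eqVneq a 0.
    by rewrite normr0 mul0r (le_trans _ (le_supf (0 *: f) 0)).
  rewrite -ler_pdivlMl ?normr_gt0// -normfV.
  by have := sup_le a^-1 (a *: f); rewrite scalerK.
rewrite -RintegralZl//; apply: eq_Rintegral => y _.
by rewrite [X in `|X|]/(a * f y) normrM.
Qed.

Let CL_norm0_eq0 f : CL_norm f = 0 -> f = 0.
Proof.
move=> /eqP; rewrite paddr_eq0; last 2 first.
  by rewrite (le_trans _ (le_supf f 0)).
  by apply: Rintegral_ge0.
move=> /andP[/eqP f0 _]; apply/val_inj/funext => y /=.
by apply/eqP; rewrite -normr_le0 -f0.
Qed.

HB.instance Definition _ :=
  Lmodule_isNormed.Build R CL CL_normD CL_normZ CL_norm0_eq0.

Lemma CL_normE (f : CL) :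
  `|f| = sup (range (fun y => `|f y|)) + \int[leb]_y `|f y|.
Proof. by []. Qed.

End CL.

Section brownian_motion.
Context (R : realType) (d : nat) (disp : measure_display)
  (Omega : measurableType disp) (P : probability Omega R).

(* The generator of the semigroup of N(0, sigma^2 t I_d) is (sigma^2 / 2) times
   the Laplace operator, so the generator Delta (without the factor 1/2)
   corresponds to sigma^2 = 2: the product below is the heat kernel
   (4 pi tau)^(-d/2) exp (- |y|^2 / (4 tau)). *)
Definition heat_kernel (tau : R) (y : 'rV[R]_d) : R :=
  \prod_(i < d) normal_pdf 0 (Num.sqrt (2 * tau)) (y ord0 i).

Definition increment (B : R -> Omega -> 'rV[R]_d) (s t : R) (w : Omega) :
  'rV[R]_d := B t w - B s w.

(* Only the values of B at nonnegative times matter. Mutual independence of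
   increments is stated for full families only: taking some A i equal to setT
   gives the product rule for subfamilies. *)
Definition brownian_motion (B : R -> Omega -> 'rV[R]_d) (x : 'rV[R]_d) : Prop :=
  [/\ forall t, 0 <= t -> measurable_fun [set: Omega] (B t),
      {ae P, forall w, B 0 w = x},
      forall (n : nat) (t : nat -> R) (A : nat -> set 'rV[R]_d),
        0 <= t 0%N -> nondecreasing_seq t -> (forall i, measurable (A i)) ->
        P (\bigcap_(i < n) (increment B (t i) (t i.+1) @^-1` A i)) =
        (\prod_(i < n) P (increment B (t i) (t i.+1) @^-1` A i))%E,
      forall (s t : R) (A : set 'rV[R]_d), 0 <= s -> s < t -> measurable A ->
        P (increment B s t @^-1` A) =
        (\int[@lebesgue_rV R d]_(y in A) (heat_kernel (t - s) y)%:E)%E &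
      {ae P, forall w, {within `[0, +oo[, continuous (fun t => B t w)}}].

Definition time_integral (B : R -> Omega -> 'rV[R]_d) (f : 'rV[R]_d -> R)
  (T : R) (w : Omega) : R := \int[@lebesgue_measure R]_(t in `[0, T]) f (B t w).

(* Y is the limit in L^1(P), as T tends to +oo, of the class of the random
   variable time_integral B f T. The class is described up to a.e. equality
   because paths are continuous only almost surely. *)
Definition is_improper_time_integral (B : R -> Omega -> 'rV[R]_d)
    (f : 'rV[R]_d -> R) (Y : L1 P) : Prop :=
  exists2 U : R -> L1 P,
    forall T, 0 <= T -> {ae P, forall w, U T w = time_integral B f T w} &
    U T @[T --> +oo] --> Y.

End brownian_motion.

Section vector_measure.
Import HBSimple.
Context (R : realType) (d : nat) (V : normedModType R).
Implicit Types (mu : set 'rV[R]_d -> V) (D : set 'rV[R]_d) (f : 'rV[R]_d -> R).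

Definition bounded_borel D : Prop := measurable D /\ bounded_set D.

(* Vector measures are defined on bounded Borel sets only: the value of mu on
   any other set is irrelevant. *)
Definition vsigma_additive mu : Prop :=
  forall A : nat -> set 'rV[R]_d, (forall n, bounded_borel (A n)) ->
    trivIset setT A -> bounded_borel (\bigcup_n A n) ->
    series (fun n => mu (A n)) @ \oo --> mu (\bigcup_n A n).

Definition vsintegral mu D (s : {sfun 'rV[R]_d >-> R}) : V :=
  \sum_(r \in range s) r *: mu (D `&` s @^-1` [set r]).

(* For D bounded Borel and f bounded Borel on D. Such an f is a uniform limit
   on D of simple functions, so v is unique. *)
Definition is_vintegral mu D f (v : V) : Prop :=
  forall s : nat -> {sfun 'rV[R]_d >-> R},
    {uniform D, (fun n => s n : 'rV[R]_d -> R) @ \oo --> f} ->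
    vsintegral mu D (s n) @[n --> \oo] --> v.

Definition euclidean_ball (r : R) : set 'rV[R]_d :=
  [set y | Num.sqrt (\sum_(i < d) y ord0 i ^+ 2) <= r].

Definition is_vintegral_space mu f (v : V) : Prop :=
  exists2 I : nat -> V,
    forall N, is_vintegral mu (euclidean_ball N%:R) f (I N) &
    I @ \oo --> v.

End vector_measure.

(* Main.v *)
From HB Require Import structures.
Require Import Defs.
From mathcomp Require Import all_boot all_order all_algebra.
From mathcomp Require Import all_classical all_reals all_analysis.
From mathcomp Require Import measurable_realfun ring lra.
Set Implicit Arguments.
Unset Strict Implicit.
Unset Printing Implicit Defensive.
Import Order.TTheory GRing.Theory Num.Theory.
Import numFieldNormedType.Exports.
Local Open Scope classical_set_scope.
Local Open Scope ring_scope.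

(** Both Y and the representing measure come from one linear operator, the
integration along the path
[J h = int_0^oo h (B t) dt], with [Y f = J f] and [mu A = J 1_A].

By Tonelli, the norm of [J h] in L^1(P) is at most the integral of [|h|]
against the occupation measure [G A = int_0^oo P (B t \in A) dt].
All the existence claims follow from this bound and from an estimate of [G].
For [t >= 1] and [d >= 3] the density of [B t] is at most
[(4 pi t)^(-d/2) <= t^(-3/2)], which is integrable at infinity, while for
[t < 1] the expectation of [h (B t)] is at most [sup h]; hence
[int h dG <= sup h + 2 int h dy] for [h >= 0] ([integral_occupation_le]).
So [Y] is bounded on CL, [G] is finite on bounded Borel sets, and cutting the
time integral at [T] costs at most [2 T^(-1/2) int |f| dy]
([occupation_operator_tail]), which gives the limit defining [Y f].
An operator dominated by a measure that is finite on bounded sets satisfies a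
dominated convergence theorem ([operator_dominated_cvg]); applied to indicators
it yields the strong sigma-additivity of [mu], and it identifies the integral of
[f] over a bounded set [D] with [J (f 1_D)] and the integral over the whole
space with [J f] ([is_vintegral_space_operator_measure]).

Measurability needs some care: paths are continuous only almost surely and
each [B t] is measurable separately, so [B] is first modified on a null event
into a map that is jointly measurable in time and in the random parameter
([brownian_jointly_measurable_version]).

For uniqueness, let [lam] be the difference of two representing measures, paired
with the indicator of an event. It is a real signed measure on
bounded Borel sets that annihilates the continuous functions with support in a
given ball. By the Jordan decomposition it is, on that ball, a difference of two
finite measures; these agree on the open subsets, because the indicator of an
open set is a limit of continuous bumps, and therefore on all Borel
subsets ([scalar_measure_eq0]). As the event is arbitrary, the two vector
measures coincide ([L1_vector_measure_unique]). *)

(** * Classes of integrable functions and integration along fibres *)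

Section L1_of_integrable.
Context d (T : measurableType d) (R : realType).
Context (mu : {measure set T -> \bar R}).
Implicit Types (f g : T -> R) (u v : L1 mu).

(** Totalised with the junk value 0, so that classes can be named without
carrying a proof of integrability. *)
Definition toL1 f : L1 mu :=
  if pselect (mu.-integrable setT (EFin \o f)) is left intf
  then L1_class (Lfun_Sub _ ((Lfun1_integrable mu f).2 intf)) else 0.

Lemma toL1E f : mu.-integrable setT (EFin \o f) ->
  (toL1 f : T -> R) = f %[ae mu].
Proof. by rewrite /toL1; case: pselect => // intf _; exact: L1_classE. Qed.

Lemma integrable_L1_fun u : mu.-integrable setT (EFin \o u).
Proof. by apply/Lfun1_integrable; exact: L1_fun_Lfun. Qed.

Lemma EFin_normr_L1 u : (`|u|%:E = \int[mu]_t `|u t|%:E)%E.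
Proof.
rewrite L1_normE fineK ?Lnorm1//.
exact: (integrable_fin_num _ (integrable_norm (integrable_L1_fun u))).
Qed.

Lemma normr_L1E u : `|u| = \int[mu]_t `|u t|.
Proof. by rewrite /Rintegral -EFin_normr_L1. Qed.

Lemma toL1_ae f g : mu.-integrable setT (EFin \o f) ->
  mu.-integrable setT (EFin \o g) -> f = g %[ae mu] -> toL1 f = toL1 g.
Proof.
move=> intf intg fg; apply/L1P; apply: ae_eq_trans (toL1E intf) _.
by apply: ae_eq_trans fg _; exact/ae_eq_sym/toL1E.
Qed.

Lemma toL1_linear (a : R) f g : mu.-integrable setT (EFin \o f) ->
  mu.-integrable setT (EFin \o g) ->
  toL1 (fun t => a * f t + g t) = a *: toL1 f + toL1 g.
Proof.
move=> intf intg.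
have intafg : mu.-integrable setT (EFin \o (fun t => a * f t + g t)).
  apply: (eq_integrable _ (fun t => a%:E * (f t)%:E + (g t)%:E)%E) => //.
  by apply: integrableD => //; exact: integrableZl.
apply/L1P; apply: ae_eq_trans (toL1E intafg) _; apply: ae_eq_sym.
apply: ae_eq_trans (L1_funD _ _) _.
have := L1_funZ a (toL1 f); have := toL1E intf; have := toL1E intg.
by apply: filterS3 => t /= gt ft aft _; rewrite aft// ft// gt.
Qed.

Lemma normr_toL1 f : mu.-integrable setT (EFin \o f) ->
  `|toL1 f| = \int[mu]_t `|f t|.
Proof.
move=> intf; rewrite normr_L1E; congr fine; apply: ae_eq_integral => //.
- exact: (measurable_int _ (integrable_norm (integrable_L1_fun _))).
- exact: (measurable_int _ (integrable_norm intf)).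
- by have := toL1E intf; apply: filterS => t /= ft _; rewrite ft.
Qed.

End L1_of_integrable.

Section fiber_integral.
Context d1 d2 (T1 : measurableType d1) (T2 : measurableType d2) (R : realType).
Context (m1 : {sigma_finite_measure set T1 -> \bar R}).
Context (m2 : {sigma_finite_measure set T2 -> \bar R}).
Local Notation m12 := (m1 \x m2)%E.
Implicit Types F G : T1 * T2 -> R.

Definition fiber_integral F : L1 m1 := toL1 m1 (fun x => \int[m2]_y F (x, y)).

(** The fibre integral may be infinite on a null set, where [Rintegral] is 0;
this only decreases absolute values. *)
Lemma integrable_Rintegral_fiber F : m12.-integrable setT (EFin \o F) ->
  m1.-integrable setT (EFin \o (fun x => \int[m2]_y F (x, y))).
Proof.
move=> intF; have intf := integrable_fubini_F intF.
apply: (le_integrable measurableT _ _ intf).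
  apply/measurable_EFinP.
  exact: (measurableT_comp (fine_measurable measurableT) (measurable_int _ intf)).
move=> x _; rewrite /Rintegral /fubini_F /=.
by case: (\int[m2]_y (F (x, y))%:E)%E => //=; rewrite normr0 ?leey.
Qed.

Lemma fiber_integralE F : m12.-integrable setT (EFin \o F) ->
  (fiber_integral F : T1 -> R) = (fun x => \int[m2]_y F (x, y)) %[ae m1].
Proof. by move=> /integrable_Rintegral_fiber; exact: toL1E. Qed.

(** Only the fibres on which both sections are integrable obey linearity; by
Fubini they are almost all fibres. *)
Lemma fiber_integral_linear (a : R) F G :
  m12.-integrable setT (EFin \o F) -> m12.-integrable setT (EFin \o G) ->
  fiber_integral (fun z => a * F z + G z) =
  a *: fiber_integral F + fiber_integral G.
Proof.
move=> intF intG.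
have intFG : m12.-integrable setT (EFin \o (fun z => a * F z + G z)).
  apply: (eq_integrable _ (fun t => a%:E * (F t)%:E + (G t)%:E)%E) => //.
  by apply: integrableD => //; exact: integrableZl.
have IF := integrable_Rintegral_fiber intF.
have IG := integrable_Rintegral_fiber intG.
rewrite -(toL1_linear a IF IG).
apply: toL1_ae; first exact: (integrable_Rintegral_fiber intFG).
  apply: (eq_integrable _ (fun x => a%:E * (\int[m2]_y F (x, y))%:E +
    (\int[m2]_y G (x, y))%:E)%E) => //.
  by apply: integrableD => //; exact: integrableZl.
have := ae_integrable1 intF; have := ae_integrable1 intG.
apply: filterS2 => x intGx intFx _ /=.
rewrite -RintegralZl//.
rewrite -RintegralD//.
by apply: (eq_integrable _ (fun y => a%:E * (F (x, y))%:E)%E) => //;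
  apply: integrableZl => //; exact: intFx.
Qed.

(** Fibre integration is a contraction from L^1 of the product to L^1 of
the base, by Tonelli. *)
Lemma le_normr_fiber_integral F : m12.-integrable setT (EFin \o F) ->
  `|fiber_integral F| <= \int[m12]_z `|F z|.
Proof.
move=> intF; have mF := measurable_int _ intF.
have intfF := integrable_Rintegral_fiber intF.
rewrite normr_toL1//; apply: fine_le.
- exact: (integrable_fin_num _ (integrable_norm intfF)).
- exact: (integrable_fin_num _ (integrable_norm intF)).
have mFn : measurable_fun setT (fun z => `|F z|%:E).
  exact: (measurable_int _ (integrable_norm intF)).
rewrite (fubini_tonelli1 _ mFn)//; apply: ge0_le_integral => //.
- exact: (measurable_int _ (integrable_norm intfF)).
- by apply: (measurable_fun_fubini_tonelli_F _ mFn).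
move=> x _; rewrite /fubini_F.
have le1 : (`|(\int[m2]_y F (x, y))|%:E <= `|\int[m2]_y (F (x, y))%:E|)%E.
  rewrite /Rintegral; case: (\int[m2]_y (F (x, y))%:E)%E => //=;
    by rewrite normr0 ?leey.
apply: (le_trans le1); apply: le_abse_integral => //.
exact: (measurableT_comp mF (pair1_measurable x)).
Qed.

End fiber_integral.

(** * Bounded Borel sets and Euclidean balls *)

Section bounded_borel_sets.
Context (R : realType) (d : nat).
Local Notation E := 'rV[R]_d.

Lemma bounded_borel_subset (A B : set E) : measurable A -> A `<=` B ->
  bounded_borel B -> bounded_borel A.
Proof.
move=> mA AB [mB [M [Mr bB]]]; split=> //.
by exists M; split=> // x Mx y /AB; exact: bB.
Qed.

Lemma le_coord_normr (y : E) i : `|y ord0 i| <= `|y|.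
Proof.
rewrite [leRHS]/Num.norm /= mx_normrE.
exact: (@le_bigmax _ _ _ _ (fun ij : 'I_1 * 'I_d => `|y ij.1 ij.2|) (ord0, i)).
Qed.

Lemma normr_rV_le (y : E) (c : R) : 0 <= c ->
  (forall i, `|y ord0 i| <= c) -> `|y| <= c.
Proof.
move=> c0 yc; rewrite [leLHS]/Num.norm /= mx_normrE.
by apply/bigmax_leP; split => // -[i j] _; rewrite /= ord1.
Qed.

Lemma measurable_coord (i : 'I_d) :
  measurable_fun [set: E] (fun y : E => y ord0 i).
Proof. by apply: continuous_measurable_mx; exact: coord_continuous. Qed.

Lemma euclidean_ball_bounded_borel (r : R) :
  bounded_borel (@euclidean_ball R d r).
Proof.
split.
  rewrite -[X in measurable X]setTI.
  have mq : measurable_fun [set: E]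
      (fun y : E => Num.sqrt (\sum_(i < d) y ord0 i ^+ 2)).
    have msum : measurable_fun [set: E] (fun y : E => \sum_(i < d) y ord0 i ^+ 2).
      by apply: measurable_sum => i; apply: measurable_funX; exact: measurable_coord.
    exact: (measurableT_comp (continuous_measurable_fun (@sqrt_continuous R)) msum).
  have := mq measurableT _ (measurable_itv `]-oo, r]).
  by congr measurable; apply/seteqP; split=> y [_ yr]; split=> //;
    move: yr; rewrite /euclidean_ball/= in_itv.
exists `|r|; split; first exact: num_real.
move=> c rc y yr; apply: (le_trans _ (ltW rc)).
apply: normr_rV_le => // i; apply: (le_trans _ (ler_norm _)).
apply: (le_trans _ yr); rewrite -sqrtr_sqr ler_sqrt ?sumr_ge0//.
  by rewrite (bigD1 i)//= lerDl sumr_ge0// => j _; exact: sqr_ge0.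
by move=> j _; exact: sqr_ge0.
Qed.

(** The norm of row vectors is the maximum norm, so the Euclidean length of [y]
is at most [sqrt d * |y| <= d * |y|]. *)
Lemma ball0_subset_euclidean_ball (M r : R) : d%:R * M <= r ->
  [set y : E | `|y| < M] `<=` euclidean_ball r.
Proof.
move=> dMr y yM; have M0 : 0 < M by exact: le_lt_trans yM.
apply: le_trans dMr.
have dM0 : 0 <= d%:R * M by rewrite mulr_ge0// ltW.
rewrite -[leRHS]ger0_norm// -sqrtr_sqr ler_sqrt ?sqr_ge0//.
apply: (@le_trans _ _ (\sum_(i < d) M ^+ 2)).
  apply: ler_sum => i _; rewrite -real_normK ?num_real//.
  apply: lerXn2r; rewrite ?nnegrE ?(ltW M0)//.
  exact: le_trans (le_coord_normr _ _) (ltW yM).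
rewrite sumr_const card_ord -[leLHS]mulr_natl exprMn ler_pM2r ?exprn_gt0//.
by rewrite -natrX ler_nat; rewrite -mulnn; case: (d) => // n; exact: leq_pmulr.
Qed.

Lemma near_euclidean_ball (y : E) :
  \forall N \near \oo, euclidean_ball N%:R y.
Proof.
near=> N; apply: (@ball0_subset_euclidean_ball (`|y| + 1)); last by rewrite /= ltrDl.
by near: N; exact: nbhs_infty_ger.
Unshelve. all: by end_near. Qed.

End bounded_borel_sets.

(** * The vector measure of an operator dominated by a measure *)

Section uniform_convergence.
Context (R : realType) (T : choiceType).

(** The metric form of the uniform convergence that occurs in the definition of
the vector integral. *)
Lemma uniform_cvgP (D : set T) (s : nat -> T -> R) (f : T -> R) :
  {uniform D, s @ \oo --> f} <->
  forall e, 0 < e -> \forall n \near \oo, forall y, D y -> `|f y - s n y| < e.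
Proof.
split=> [sf e e0|sf P].
  have := sf [set h | forall y, D y -> `|f y - h y| < e]; apply.
  apply/uniform_nbhs; exists [set xy : R * R | ball xy.1 e xy.2]; split=> //.
  exact: entourage_ball (PosNum e0).
move=> /uniform_nbhs[E [/= + EP]]; rewrite -entourage_ballE => -[e/= e0 eE].
have := sf _ e0; apply: filterS => n fsn; apply: EP => y Dy; apply: eE.
exact: fsn.
Qed.

End uniform_convergence.

Section dominated_operator.
Import HBSimple.
Context (R : realType) (d : nat) (V : normedModType R).
Context (G : {measure set 'rV[R]_d -> \bar R}) (J : ('rV[R]_d -> R) -> V).
Local Notation E := 'rV[R]_d.
Local Notation intG f := (G.-integrable [set: E] (EFin \o f)).
Hypothesis J_linear : forall (a : R) (f g : E -> R), intG f -> intG g ->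
  J (fun y => a * f y + g y) = a *: J f + J g.
Hypothesis le_normr_J : forall f : E -> R, intG f -> `|J f| <= \int[G]_y `|f y|.
Hypothesis G_bounded_borel : forall A, bounded_borel A -> (G A < +oo)%E.

Definition operator_measure (A : set E) : V := J \1_A.
Local Notation mu := operator_measure.

Let integrable_lincomb (a : R) f g : intG f -> intG g ->
  intG (fun y => a * f y + g y).
Proof.
move=> intf intg.
apply: (eq_integrable _ (fun y => a%:E * (f y)%:E + (g y)%:E)%E) => //.
by apply: integrableD => //; exact: integrableZl.
Qed.

Let J0 : J (fun=> 0) = 0.
Proof.
apply/eqP; rewrite -normr_le0; apply: le_trans (le_normr_J _) _.
  exact: integrable0.
by rewrite /Rintegral; under eq_integral do rewrite normr0; rewrite integral0.
Qed.

Let le_normr_JB f g : intG f -> intG g ->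
  `|J f - J g| <= \int[G]_y `|f y - g y|.
Proof.
move=> intf intg.
have -> : J f - J g = J (fun y => -1 * g y + f y).
  by rewrite J_linear// scaleN1r addrC.
apply: le_trans (le_normr_J (integrable_lincomb _ intg intf)) _.
by rewrite le_eqVlt; apply/orP; left; apply/eqP; apply: eq_Rintegral => y _;
  rewrite mulN1r addrC.
Qed.

(** The distance between two values of [J] is at most the L^1(G) distance of the
arguments, which tends to 0 by dominated convergence. *)
Lemma operator_dominated_cvg (f_ : nat -> E -> R) (f g : E -> R) :
  (forall n, measurable_fun setT (f_ n)) -> measurable_fun setT f -> intG g ->
  (forall y, f_ ^~ y @ \oo --> f y) -> (forall n y, `|f_ n y| <= g y) ->
  J (f_ n) @[n --> \oo] --> J f.
Proof.
move=> mf_ mf intg f_f f_g.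
have intf_ n : intG (f_ n).
  apply: (le_integrable measurableT _ _ intg); first exact/measurable_EFinP.
  move=> y _ /=; rewrite lee_fin (le_trans (f_g n y))// ler_norm//.
have intf : intG f.
  apply: (le_integrable measurableT _ _ intg); first exact/measurable_EFinP.
  move=> y _ /=; rewrite lee_fin (le_trans _ (ler_norm _))//.
  have /cvg_norm fy := f_f y.
  rewrite -(cvg_lim (@Rhausdorff R) fy).
  by apply: limr_le; [apply/cvg_ex; eexists; exact: fy|exact: nearW].
have ef_ n : measurable_fun setT (EFin \o f_ n) by exact/measurable_EFinP.
have ef : measurable_fun setT (EFin \o f) by exact/measurable_EFinP.
have aef : {ae G, forall y, setT y -> EFin (f_ n y) @[n --> \oo] --> EFin (f y)}.
  by apply: aeW => y _; apply: cvg_EFin; [exact: nearW|exact: f_f].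
have aeg : {ae G, forall y n, setT y -> (`|EFin (f_ n y)| <= (EFin \o g) y)%E}.
  by apply: aeW => y n _ /=; rewrite lee_fin.
have [_ + _] := dominated_convergence measurableT ef_ ef aef intg aeg.
move=> /fine_cvgP[_ cvg0].
apply/subr_cvg0/norm_cvg0P.
apply: (@squeeze_cvgr _ _ _ _ (cst 0)
  (fun n => \int[G]_y `|f_ n y - f y|)); last 2 first.
- exact: cvg_cst.
- exact: cvg0.
by apply: nearW => n; rewrite normr_ge0 /=; exact: le_normr_JB.
Qed.

Lemma integrable_indic_bounded_borel A : bounded_borel A -> intG \1_A.
Proof.
move=> [mA bA]; apply/integrableP; split; first exact/measurable_EFinP.
rewrite (eq_integral (fun y => (\1_A y)%:E)); last first.
  by move=> y _ /=; rewrite ger0_norm.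
by rewrite integral_indic// setIT; exact: G_bounded_borel.
Qed.

Lemma operator_sum (I : Type) (r : seq I) (a : I -> R) (f : I -> E -> R) :
  (forall i, intG (f i)) ->
  intG (fun y => \sum_(i <- r) a i * f i y) /\
  J (fun y => \sum_(i <- r) a i * f i y) = \sum_(i <- r) a i *: J (f i).
Proof.
move=> intf; elim: r => [|i r [IH1 IH2]].
  rewrite big_nil; split; last first.
    by rewrite -[RHS]J0; congr J; apply/funext => y; rewrite big_nil.
  by under eq_fun do rewrite big_nil; exact: integrable0.
rewrite big_cons -IH2 -J_linear//.
have -> : (fun y => \sum_(j <- i :: r) a j * f j y) =
    (fun y => a i * f i y + \sum_(j <- r) a j * f j y).
  by apply/funext => y; rewrite big_cons.
by split=> //; exact: integrable_lincomb.
Qed.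

(** The partial sums are the values of [J] at the indicators of the finite
unions, and these indicators are dominated by that of the whole union. *)
Lemma operator_measure_sigma_additive : vsigma_additive mu.
Proof.
move=> A bA tA bU.
have sumE n y : \sum_(i <- index_iota 0 n) 1 * \1_(A i) y =
    \1_(\big[setU/set0]_(i < n) A i) y :> R.
  elim: n => [|n IH]; first by rewrite big_nil big_ord0 indic0.
  rewrite big_nat_recr//= IH big_ord_recr/= mul1r !indicE in_setU -natrD.
  congr (_%:R); case: (boolP (y \in A n)) => [yA|]; last by rewrite orbF addn0.
  rewrite orbT memNset//.
  rewrite -bigcup_mkord => -[k /= kn Aky].
  have /trivIsetP/(_ n k Logic.I Logic.I) := tA; rewrite gtn_eqF// => /(_ isT).
  by move=> /seteqP[/(_ y)] + _; apply; split => //; exact/set_mem.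
have -> : series (fun n => mu (A n)) =
    (fun n => J \1_(\big[setU/set0]_(i < n) A i)).
  apply/funext => n; rewrite /series /=.
  have [|_] := operator_sum (index_iota 0 n) (fun=> 1) (f := fun i => \1_(A i)).
    by move=> i; exact: integrable_indic_bounded_borel.
  under [X in J X]eq_fun do rewrite sumE.
  by move=> ->; apply: eq_bigr => i _; rewrite scale1r.
apply: (@operator_dominated_cvg _ _ \1_(\bigcup_n A n)).
- move=> n; apply: measurable_indic; apply: bigsetU_measurable => i _.
  by case: (bA i).
- by apply: measurable_indic; case: bU.
- exact: integrable_indic_bounded_borel.
- move=> y; have [[k _ Aky]|nA] := pselect ((\bigcup_n A n) y).
    apply: cvg_near_cst; exists k.+1 => // n /= kn; rewrite !indicE.
    by rewrite !mem_set//; [exists k|rewrite -bigcup_mkord; exists k].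
  apply: cvg_near_cst; apply: nearW => n; rewrite !indicE.
  rewrite !memNset// -bigcup_mkord => -[k _ Aky].
  by apply: nA; exists k.
move=> n y; rewrite ger0_norm// !indicE ler_nat.
case: (boolP (y \in \big[setU/set0]_(i < n) A i)) => // /set_mem.
by rewrite -bigcup_mkord => -[k _ Aky]; rewrite mem_set//; exists k.
Qed.

(** On simple functions the vector integral is [J] of the truncated function,
by linearity over the finitely many level sets. *)
Lemma vsintegral_operator_measure D (s : {sfun E >-> R}) : bounded_borel D ->
  intG (fun y => s y * \1_D y) /\
  vsintegral mu D s = J (fun y => s y * \1_D y).
Proof.
move=> bD; have finr : finite_set (range s) by exact: fimfunP.
have bDs r : bounded_borel (D `&` s @^-1` [set r]).
  apply: (bounded_borel_subset _ _ bD) => //; apply: measurableI; first by case: bD.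
  exact: measurable_sfunP.
rewrite /vsintegral fsbig_finite//=.
have [|intJ JE] := operator_sum (finmap.enum_fset (fset_set (range s))) id
  (f := fun r => \1_(D `&` s @^-1` [set r])).
  by move=> r; exact: integrable_indic_bounded_borel.
have sE : (fun y => \sum_(r <- finmap.enum_fset (fset_set (range s))) id r *
    \1_(D `&` s @^-1` [set r]) y) = (fun y => s y * \1_D y).
  apply/funext => y; rewrite [in RHS]fimfunE fsbig_finite//= mulr_suml.
  by apply: eq_bigr => r _; rewrite indicI /= mulrAC mulrA.
by rewrite -sE; split=> //; rewrite JE.
Qed.

(** A uniform error [e] on [D] changes [J (f 1_D)] by at most [e * G D], and
[G D] is finite. On [D] the function [f] is within distance 1 of one of the
simple functions, which makes it integrable there. *)
Lemma is_vintegral_operator_measure D f : bounded_borel D ->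
  measurable_fun setT f -> is_vintegral mu D f (J (fun y => f y * \1_D y)).
Proof.
move=> bD mf s /uniform_cvgP sf; have mD : measurable D by case: bD.
have GD := G_bounded_borel bD.
have cvgs : \forall n \near \oo, forall y, D y -> `|f y - s n y| < 1.
  exact: sf.
have intf : intG (fun y => f y * \1_D y).
  have [n _ /(_ n (leqnn n)) sn] := cvgs.
  have [ints _] := vsintegral_operator_measure (s n) bD.
  have intD := integrable_indic_bounded_borel bD.
  apply: (@le_integrable _ _ _ G setT measurableT _
    (fun y => (`|s n y * \1_D y| + \1_D y)%:E)).
  - by apply/measurable_EFinP; apply: measurable_funM.
  - move=> y _ /=; rewrite lee_fin [leRHS]ger0_norm ?addr_ge0//.
    rewrite !normrM indicE; case: (boolP (y \in D)) => [/set_mem Dy|_]; last first.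
      by rewrite normr0 !mulr0 addr0.
    rewrite normr1 !mulr1.
    have := ler_normD (f y - s n y) (s n y); rewrite subrK => /le_trans; apply.
    by rewrite addrC lerD2l ltW// sn.
  - apply: (eq_integrable measurableT _ _ _
      (integrableD measurableT (integrable_norm ints) intD)) => //.
apply/cvgrPdist_lt => e e0.
(* the summand 1 keeps the denominator positive when G D = 0 *)
pose M := fine (G D) + 1.
have M0 : 0 < M by rewrite ltr_wpDl// fine_ge0.
have := sf (e / M) (divr_gt0 e0 M0); apply: filterS => n sn.
have [ints ->] := vsintegral_operator_measure (s n) bD.
apply: (le_lt_trans (le_normr_JB intf ints)).
have intD := integrable_indic_bounded_borel bD.
apply: (@le_lt_trans _ _ (\int[G]_y (e / M * \1_D y))).
  apply: le_Rintegral => //.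
  - have := integrable_norm (integrable_lincomb (-1) ints intf).
    by apply: eq_integrable => // y _ /=; rewrite mulN1r addrC.
  - by have := integrableZl measurableT (e / M) intD; apply: eq_integrable.
  move=> y _; rewrite -mulrBl normrM (ger0_norm (_ : 0 <= \1_D y))// indicE.
  case: (boolP (y \in D)) => [/set_mem Dy|_]; last by rewrite !mulr0.
  by rewrite !mulr1 ltW// sn.
rewrite RintegralZl//= /Rintegral integral_indic// setIT.
by rewrite mulrAC ltr_pdivrMr// ltr_pM2l// /M ltrDl.
Qed.

Lemma is_vintegral_space_operator_measure f : measurable_fun setT f -> intG f ->
  is_vintegral_space mu f (J f).
Proof.
move=> mf intf.
exists (fun N => J (fun y => f y * \1_(@euclidean_ball R d N%:R) y)).
  by move=> N; apply: is_vintegral_operator_measure => //;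
    exact: euclidean_ball_bounded_borel.
apply: (@operator_dominated_cvg _ _ (fun y => `|f y|)) => //.
- move=> N; apply: measurable_funM => //; apply: measurable_indic.
  by case: (euclidean_ball_bounded_borel d (N%:R : R)).
- exact: (integrable_norm intf).
- move=> y; apply: cvg_near_cst; have := near_euclidean_ball y.
  by apply: filterS => N yN; rewrite indicE mem_set// mulr1.
- move=> N y; rewrite indicE; case: (_ \in _); first by rewrite mulr1.
  by rewrite mulr0 normr0.
Qed.

End dominated_operator.

(** * Lebesgue measure on row vectors *)

Section lebesgue_rV_theory.
Context (R : realType).
Local Notation leb := (@lebesgue_measure R).

Lemma continuous_measurable_rV m n m' n'
    (f : 'M[R]_(m, n) -> 'M[R]_(m', n')) :
  continuous f -> measurable_fun [set: 'M[R]_(m, n)] f.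
Proof.
move=> /continuousP cf.
apply: (measurability (@open 'M[R]_(m', n'))) => // _ [U oU <-].
by rewrite setTI; apply: open_measurable_mx; exact: cf.
Qed.

Let shift1 (a : R) : measurableTypeR R -> measurableTypeR R := fun t => t + a.

Let measurable_shift1 a : measurable_fun setT (shift1 a).
Proof. by apply: measurable_funD. Qed.

Let lebesgue_measure_shift (a : R) (A : set (measurableTypeR R)) : measurable A ->
  pushforward leb (shift1 a) A = leb A.
Proof.
move=> mA; apply/esym.
have := @lebesgue_measure_unique R (pushforward leb (shift1 a)).
apply => //= _ [[b c]] _ <-; rewrite /pushforward.
have -> : shift1 a @^-1` `]b, c] = `]b - a, c - a]%classic.
  by apply/seteqP; split=> t /=; rewrite /shift1 !in_itv/= ltrBlDr lerBrDr.
by rewrite !lebesgue_measure_itv/= !lte_fin ltrD2r -!EFinB; case: ifPn => // _;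
  congr EFin; lra.
Qed.

Let measurable_shift n (v : 'rV[R]_n) :
  measurable_fun [set: 'rV[R]_n] (fun y => y + v).
Proof.
apply: continuous_measurable_rV => y.
by apply: (@continuousD _ _ _ id (cst v)); [exact: cvg_id|exact: cst_continuous].
Qed.

(** By induction on the dimension: a translation acts separately on the first
coordinate and on the others, so the translated product measure has the same
values on rectangles, and such a measure is unique. *)
Lemma lebesgue_rV_shift n (v : 'rV[R]_n) (A : set 'rV[R]_n) : measurable A ->
  lebesgue_rV R n ((fun y => y + v) @^-1` A) = lebesgue_rV R n A.
Proof.
elim: n v A => [|n IH] v A mA.
  suff -> : (fun y : 'rV[R]_0 => y + v) = id by [].
  by apply/funext => y; apply/rowP => -[].
rewrite lebesgue_rVS /pushforward.
pose a := v ord0 ord0; pose w := \row_j v ord0 (lift ord0 j).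
pose sh (p : measurableTypeR R * 'rV[R]_n) : measurableTypeR R * 'rV[R]_n :=
  (shift1 a p.1, p.2 + w).
have msh : measurable_fun setT sh.
  apply: measurable_fun_pair => /=.
    exact: (measurableT_comp (measurable_shift1 a) measurable_fst).
  exact: (measurableT_comp (measurable_shift w) measurable_snd).
have -> : @cons_rV R n @^-1` ((fun y => y + v) @^-1` A) =
    sh @^-1` (@cons_rV R n @^-1` A).
  apply/seteqP; split=> -[t y] /=; congr A; apply/rowP => i; rewrite !mxE/=;
    by case: unliftP => [j|] ->; rewrite /= ?mxE.
have mcA : measurable (@cons_rV R n @^-1` A).
  by rewrite -[X in measurable X]setTI; exact: measurable_cons_rV.
apply/esym.
apply: (@product_measure_unique _ _ _ _ R leb (lebesgue_rV R n)
  (pushforward (leb \x lebesgue_rV R n)%E sh)) => //= X Y mX mY.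
rewrite /pushforward.
have -> : sh @^-1` (X `*` Y) =
  (shift1 a @^-1` X) `*` ((fun y => y + w) @^-1` Y) by [].
rewrite product_measure1E//; last 2 first.
- by rewrite -[X in measurable X]setTI; exact: measurable_shift1.
- by rewrite -[X in measurable X]setTI; exact: measurable_shift.
by rewrite IH//; congr (_ * _)%E; exact: lebesgue_measure_shift.
Qed.

Lemma lebesgue_rV_bounded_borel n (A : set 'rV[R]_n) : bounded_borel A ->
  (lebesgue_rV R n A < +oo)%E.
Proof.
move=> [mA [M [Mr bA]]]; pose c := `|M| + 1.
have c0 : 0 <= c by rewrite addr_ge0.
have cc : - c <= c by rewrite (le_trans _ c0)// oppr_le0.
have box := @lebesgue_rV_itv R n (fun=> - c) (fun=> c) (fun=> cc).
set Q := (X in lebesgue_rV R n X) in box.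
have QE : Q = \bigcap_(i in [set: 'I_n]) ([set: 'rV[R]_n] `&`
    [set v : 'rV[R]_n | v ord0 i \in `[- c, c]]).
  by apply/seteqP; split=> [v H i _|v H i];
    [split=> //; exact: H | exact: (H i I).2].
have mQ : measurable Q.
  rewrite QE; apply: fin_bigcap_measurable => // i _.
  exact: (measurable_coord i measurableT (measurable_itv `[- c, c])).
apply: (@le_lt_trans _ _ (lebesgue_rV R n Q)); last by rewrite box ltry.
apply: le_measure; rewrite ?inE//.
move=> v Av i; rewrite in_itv/= -ler_norml.
apply: le_trans (le_coord_normr v i) _; apply: bA => //.
by rewrite (le_lt_trans (ler_norm M))// ltrDl.
Qed.

End lebesgue_rV_theory.

(** * Decay of the heat kernel in dimension at least three *)

Section heat_kernel_decay.
Context (R : realType).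
Local Notation leb := (@lebesgue_measure R).

(** The function [t^(-3/2)]. *)
Definition decay (t : R) : R := (Num.sqrt t)^-1 ^+ 3.

Lemma decay_ge0 t : 0 <= decay t.
Proof. by rewrite exprn_ge0// invr_ge0 sqrtr_ge0. Qed.

Lemma decay_continuous (t : R) : 0 < t -> {for t, continuous decay}.
Proof.
move=> t0; have st : Num.sqrt t != 0 by rewrite gt_eqF// sqrtr_gt0.
apply: (@continuous_comp _ _ _ (fun t : R => (Num.sqrt t)^-1)
  (fun x : R => x ^+ 3)); last exact: exprn_continuous.
by apply: cvgV => //; exact: sqrt_continuous.
Qed.

Lemma measurable_decay (a : R) : 0 < a ->
  measurable_fun (`[a, +oo[ : set (measurableTypeR R)) decay.
Proof.
move=> a0.
have m0 : measurable_fun (`]0, +oo[ : set (measurableTypeR R)) decay.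
  apply: open_continuous_measurable_fun => //.
  by move=> t; rewrite inE/= in_itv/= andbT; exact: decay_continuous.
apply: (measurable_funS _ _ m0) => // t /=.
by rewrite !in_itv/= !andbT; exact: lt_le_trans.
Qed.

Lemma heat_kernel_ge0 d t (y : 'rV[R]_d) : 0 <= heat_kernel t y.
Proof. by apply: prodr_ge0 => i _; exact: normal_pdf_ge0. Qed.

(** Each factor of the heat kernel is at most [(4 pi t)^(-1/2) <= t^(-1/2)], and
this bound is at most 1 for [t >= 1], so all but three factors can be dropped. *)
Lemma heat_kernel_le_decay d t (y : 'rV[R]_d) : (3 <= d)%N -> 1 <= t ->
  heat_kernel t y <= decay t.
Proof.
move=> d3 t1; have t0 : 0 < t by exact: lt_le_trans t1.
pose r := (Num.sqrt t)^-1.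
have st1 : 1 <= Num.sqrt t by rewrite -sqrtr1 ler_wsqrtr.
have r0 : 0 <= r by rewrite invr_ge0 sqrtr_ge0.
have r1 : r <= 1 by rewrite invf_le1// (lt_le_trans _ st1).
apply: (@le_trans _ _ (\prod_(i < d) r)).
  apply: ler_prod => i _; rewrite normal_pdf_ge0/=.
  have s0 : Num.sqrt (2 * t) != 0 by rewrite gt_eqF// sqrtr_gt0 mulr_gt0.
  apply: (le_trans (normal_pdf_ub _ _ s0)).
  rewrite /normal_peak sqr_sqrtr ?mulr_ge0 ?(ltW t0)//.
  rewrite lef_pV2 ?posrE ?sqrtr_gt0//; last first.
    by rewrite mulrn_wgt0// !mulr_gt0// pi_gt0.
  apply: ler_wsqrtr.
  have := @pi_ge2 R; move: (pi) => p p2; nra.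
rewrite prodr_const card_ord /decay -/r -(subnK d3) exprD.
by rewrite ler_piMl ?exprn_ge0// exprn_ile1.
Qed.

Lemma cvg_invr_sqrt_pinfty : (Num.sqrt t)^-1 @[t --> +oo] --> (0 : R).
Proof.
apply/cvgrPdist_lt => e e0; near=> t.
have t0 : 0 < t by near: t; exact: nbhs_pinfty_gt.
have st0 : 0 < Num.sqrt t by rewrite sqrtr_gt0.
rewrite sub0r normrN ger0_norm ?invr_ge0 ?sqrtr_ge0//.
rewrite invf_plt ?posrE// -[ltLHS]ger0_norm ?invr_ge0 ?(ltW e0)// -sqrtr_sqr.
rewrite ltr_sqrt//.
by near: t; apply: nbhs_pinfty_gt; exact: num_real.
Unshelve. all: by end_near. Qed.

(** The primitive is [-2 t^(-1/2)]. *)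
Lemma integral_decay (a : R) : 1 <= a ->
  (\int[leb]_(t in `[a, +oo[) (decay t)%:E = (2 / Num.sqrt a)%:E)%E.
Proof.
move=> a1; have a0 : 0 < a by exact: lt_le_trans a1.
pose F (t : R) : R := -2 * (Num.sqrt t)^-1.
have dF (t : R) : 0 < t -> is_derive t (1 : R) F (decay t).
  move=> t0; have st : Num.sqrt t != 0 by rewrite gt_eqF// sqrtr_gt0.
  have dV := is_deriveV st (is_derive1_sqrt t0).
  have dZ := is_deriveZ (-2 : R) dV; apply: (is_derive_eq dZ).
  rewrite /decay /GRing.scale/=.
  by field.
have F0 : F t @[t --> +oo] --> (0 : R).
  by rewrite -[0](mulr0 (-2 : R)); apply: cvgMr; exact: cvg_invr_sqrt_pinfty.
have := @ge0_continuous_FTC2y R decay F a 0.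
rewrite sub0e => ->.
- by rewrite -EFinN /F mulNr opprK.
- by move=> t _; exact: decay_ge0.
- apply: continuous_in_subspaceT => t; rewrite inE/= in_itv/= andbT => at_.
  by apply: decay_continuous; exact: lt_le_trans at_.
- exact: F0.
- by move=> t at_; have := dF t (lt_trans a0 at_); case.
- apply: cvg_at_right_filter.
  by apply: differentiable_continuous; apply/derivable1_diffP; case: (dF a a0).
- move=> t; rewrite in_itv/= andbT => at_.
  by rewrite derive1E; case: (dF t (lt_trans a0 at_)).
Qed.

End heat_kernel_decay.

(** * Test functions: simple approximations and bumps on open sets *)

Section simple_approximation.
Import HBSimple.
Context (R : realType) d (T : measurableType d).

(** The approximations [floor ((n + 1) f) / (n + 1)]. That they vanish wherever
[f] does is what keeps their supports inside that of [f]. *)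
Lemma sfun_uniform_approx (f : T -> R) : measurable_fun setT f ->
  (forall y, 0 <= f y <= 1) ->
  exists s : nat -> {sfun T >-> R},
    (forall n y, f y = 0 -> s n y = 0) /\
    (forall n y, `|f y - s n y| <= n.+1%:R^-1).
Proof.
move=> mf f01.
have mA n k : measurable [set y | k.+1%:R <= f y * n.+1%:R].
  have mfn : measurable_fun setT (fun y => f y * n.+1%:R).
    by apply: measurable_funM.
  have := mfn measurableT _ (measurable_itv `[k.+1%:R, +oo[).
  by congr measurable; apply/seteqP; split=> y /=; rewrite in_itv/= andbT => // -[].
pose s n : {sfun T >-> R} :=
  \sum_(k < n.+1) cst_sfun (n.+1%:R^-1) * indic_sfun _ (mA n k).
(* the number of k with k + 1 <= a is the integer part of a *)
have sE n y : s n y = (Num.truncn (f y * n.+1%:R))%:R / n.+1%:R.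
  have /andP[f0 f1] := f01 y.
  rewrite /s sfun_sum.
  under eq_bigr do rewrite sfunM /=.
  rewrite -mulr_sumr mulrC; congr (_ / _).
  have fn0 : 0 <= f y * n.+1%:R by rewrite mulr_ge0.
  have tn : (Num.truncn (f y * n.+1%:R) <= n.+1)%N.
    rewrite -(ler_nat R); apply: le_trans (_ : f y * n.+1%:R <= _).
      by rewrite truncn_le.
    by rewrite ler_piMl.
  transitivity (\sum_(k < n.+1) (k < Num.truncn (f y * n.+1%:R))%N%:R : R).
    apply: eq_bigr => k _; rewrite /mindic indicE truncn_gt_nat.
    by congr (nat_of_bool _)%:R; apply/idP/idP => [/set_mem|kf]; [|exact: mem_set].
  rewrite -natr_sum; congr _%:R.
  set t := Num.truncn _ in tn *.
  have : (\sum_(k < t) 1)%N = t by rewrite sum1_card card_ord.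
  rewrite (big_ord_widen _ (fun=> 1%N) tn) big_mkcond => tE; rewrite -[RHS]tE.
  by apply: eq_bigr => k _; case: ifP.
exists s; split=> n y.
  by move=> f0; rewrite sE f0 mul0r truncn0 mul0r.
have /andP[f0 f1] := f01 y.
have n0 : 0 < n.+1%:R :> R by [].
have fn0 : 0 <= f y * n.+1%:R by rewrite mulr_ge0.
have /andP[t1 t2] := truncn_itv fn0.
rewrite sE -[X in `|X - _|](mulfK (lt0r_neq0 n0)) -mulrBl.
rewrite normrM [X in _ * X]ger0_norm ?invr_ge0// ler_piMl ?invr_ge0//.
by rewrite ger0_norm ?subr_ge0// lerBlDr addrC natr1 ltW.
Qed.

End simple_approximation.

Section open_set_bumps.
Context (R : realType) (d : nat) (U : set 'rV[R]_d).
Hypothesis oU : open U.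
Hypothesis bU : bounded_set U.
Local Notation E := 'rV[R]_d.

(** Truncating at 1 keeps the set of distances nonempty when [U] is the whole
space. *)
Let dists (y : E) : set R :=
  [set 1] `|` [set Num.min 1 `|y - z| | z in ~` U].

Definition truncated_dist (y : E) : R := inf (dists y).
Local Notation g := truncated_dist.

Let dists_lb y : lbound (dists y) 0.
Proof. by move=> r [->//|[z _ <-]]; rewrite le_min ler01 normr_ge0. Qed.

Let has_lb y : has_lbound (dists y). Proof. by exists 0; exact: dists_lb. Qed.

Let dists0 y : dists y !=set0. Proof. by exists 1; left. Qed.

Lemma truncated_dist_ge0 y : 0 <= g y.
Proof. by apply: lb_le_inf; [exact: dists0|exact: dists_lb]. Qed.

Lemma truncated_dist_le1 y : g y <= 1.
Proof. by apply: ge_inf => //; left. Qed.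

Lemma truncated_dist_eq0 y : ~ U y -> g y = 0.
Proof.
move=> nUy; apply/eqP; rewrite eq_le truncated_dist_ge0 andbT.
apply: ge_inf => //; right; exists y => //.
by rewrite subrr normr0 min_r.
Qed.

Lemma truncated_dist_gt0 y : U y -> 0 < g y.
Proof.
move=> Uy; have /nbhs_ballP[e/= e0 eU] : nbhs y U by exact: open_nbhs_nbhs.
apply: (@lt_le_trans _ _ (Num.min 1 e)); first by rewrite lt_min ltr01.
apply: lb_le_inf => // _ [->|[z nUz <-]]; first by rewrite ge_min lexx.
rewrite le_min !ge_min lexx /=; apply/orP; right.
by rewrite leNgt; apply/negP => yz; apply/nUz/eU; rewrite -ball_normE.
Qed.

Let lip y z : g y <= g z + `|y - z|.
Proof.
rewrite -lerBlDr; apply: lb_le_inf => // _ [->|[u nUu <-]].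
  by rewrite lerBlDr ler_wpDr// truncated_dist_le1.
rewrite lerBlDr; apply: (@le_trans _ _ (Num.min 1 `|y - u|)).
  by apply: ge_inf => //; right; exists u.
have := ler_normD (y - z) (z - u); rewrite addrA subrK => yu.
rewrite -lerBlDr le_min; apply/andP; split.
  by rewrite lerBlDr ler_wpDr// ge_min lexx.
by rewrite lerBlDr ge_min; apply/orP; right; rewrite [leRHS]addrC.
Qed.

Lemma truncated_dist_continuous : continuous (g : E -> R).
Proof.
move=> y; apply/(@cvgrPdist_lt _ _ _ (nbhs y)) => e e0.
have : nbhs y (ball y e) by exact: nbhsx_ballx.
apply: filterS => z; rewrite -ball_normE /= => yz.
rewrite ltr_norml; apply/andP; split.
  by have := lip z y; rewrite [`|z - y|]distrC; lra.
by have := lip y z; lra.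
Qed.

(** These functions increase to the indicator of [U] as [k] grows. *)
Definition open_bump (k : nat) (y : E) : R := Num.min 1 (k%:R * g y).

Lemma open_bump_ge0 k y : 0 <= open_bump k y.
Proof. by rewrite le_min ler01 mulr_ge0// truncated_dist_ge0. Qed.

Lemma open_bump_le1 k y : open_bump k y <= 1.
Proof. by rewrite ge_min lexx. Qed.

Lemma open_bump_eq0 k y : ~ U y -> open_bump k y = 0.
Proof. by move=> /truncated_dist_eq0 g0; rewrite /open_bump g0 mulr0 min_r. Qed.

Lemma open_bump_continuous k : continuous (open_bump k).
Proof.
move=> y; apply: (@continuous_min R _ (fun=> 1) (fun y => k%:R * g y) y).
  exact: cst_continuous.
apply: (@continuousM _ _ (fun=> k%:R) g); first exact: cst_continuous.
exact: truncated_dist_continuous.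
Qed.

Lemma measurable_open_bump k : measurable_fun [set: E] (open_bump k).
Proof. by apply: continuous_measurable_mx; exact: open_bump_continuous. Qed.

Lemma open_bump_cvg y : open_bump k y @[k --> \oo] --> (\1_U y : R).
Proof.
have [Uy|nUy] := pselect (U y); last first.
  rewrite indicE memNset//; apply: cvg_near_cst; apply: nearW => k.
  exact: open_bump_eq0.
rewrite indicE mem_set//; apply: cvg_near_cst.
have g0 := truncated_dist_gt0 Uy.
near=> k; apply/min_idPl; rewrite -ler_pdivrMr//.
by near: k; exact: nbhs_infty_ger.
Unshelve. all: by end_near. Qed.

Lemma open_bump_CL k : open_bump k \in @CL_pred R d.
Proof.
rewrite inE; split; first exact: open_bump_continuous.
  exists 1; split; first exact: num_real.
  by move=> c c1 y _; rewrite /= ger0_norm ?open_bump_ge0// (le_trans (open_bump_le1 _ _))// ltW.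
have mU : measurable U by exact: open_measurable_mx.
have intU : (lebesgue_rV R d).-integrable [set: E] (EFin \o \1_U).
  apply/integrableP; split; first exact/measurable_EFinP.
  rewrite (eq_integral (fun y => (\1_U y)%:E)); last first.
    by move=> y _ /=; rewrite ger0_norm.
  by rewrite integral_indic// setIT; exact: lebesgue_rV_bounded_borel.
apply: (le_integrable measurableT _ _ intU).
  by apply/measurable_EFinP; exact: measurable_open_bump.
move=> y _; rewrite /= lee_fin indicE.
case: (boolP (y \in U)) => [_|/negP nyU].
  by rewrite normr1 ger0_norm ?open_bump_ge0// open_bump_le1.
by rewrite open_bump_eq0// => Uy; apply: nyU; exact: mem_set.
Qed.

End open_set_bumps.

(** * Uniqueness of the representing measure *)

Section vsintegral_theory.
Import HBSimple.
Context (R : realType) (d : nat).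
Local Notation E := 'rV[R]_d.
Implicit Type s : {sfun E >-> R}.

Lemma vsintegral_linear (V W : normedModType R) (phi : V -> W)
    (mu : set E -> V) (D : set E) s : linear phi ->
  phi (vsintegral mu D s) = vsintegral (phi \o mu) D s.
Proof.
move=> phiL; have finr : finite_set (range s) by exact: fimfunP.
have phi0 : phi 0 = 0.
  have := phiL 1 0 0; rewrite scaler0 addr0 scale1r.
  by move=> /(congr1 (fun v => v - phi 0)); rewrite subrr addrK => <-.
rewrite /vsintegral !fsbig_finite//=.
elim: (finmap.enum_fset _) => [|r rs IH]; first by rewrite !big_nil.
by rewrite !big_cons phiL IH.
Qed.

Lemma vsintegralB (V : normedModType R) (nu mu : set E -> V) (D : set E) s :
  vsintegral (fun A => nu A - mu A) D s =
  vsintegral nu D s - vsintegral mu D s.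
Proof.
have finr : finite_set (range s) by exact: fimfunP.
rewrite /vsintegral !fsbig_finite//= -sumrB.
by apply: eq_bigr => r _; rewrite scalerBr.
Qed.

Lemma eq_vsintegral (V : normedModType R) (nu mu : set E -> V) (D : set E) s :
  measurable D -> (forall A, measurable A -> A `<=` D -> nu A = mu A) ->
  vsintegral nu D s = vsintegral mu D s.
Proof.
move=> mD numu; have finr : finite_set (range s) by exact: fimfunP.
rewrite /vsintegral !fsbig_finite//=; apply: eq_bigr => r _.
by rewrite numu//; apply: measurableI => //; exact: measurable_sfunP.
Qed.

(** The level set of the value 0 is the only one that changes with the domain,
and its measure is multiplied by 0. *)
Lemma vsintegral_support (V : normedModType R) (mu : set E -> V)
    (D D' : set E) s : D `<=` D' -> (forall y, ~ D y -> s y = 0) ->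
  vsintegral mu D' s = vsintegral mu D s.
Proof.
move=> DD' s0; have finr : finite_set (range s) by exact: fimfunP.
rewrite /vsintegral !fsbig_finite//=; apply: eq_bigr => r _.
have [->|r0] := eqVneq r 0; first by rewrite !scale0r.
congr (_ *: mu _); apply/seteqP; split=> y [Dy /= syr]; split => //.
  by apply: contrapT => /s0 sy0; move: r0; rewrite -syr sy0 eqxx.
exact: DD'.
Qed.

Lemma euclidean_ball_subset (r r' : R) : r <= r' ->
  @euclidean_ball R d r `<=` euclidean_ball r'.
Proof. by move=> rr' y; rewrite /euclidean_ball /= => /le_trans; apply. Qed.

(** The approximating functions vanish outside a fixed ball, so the integrals
over all larger balls are the same limit; hence this limit is the
integral over the whole space. *)
Lemma is_vintegral_space_support (V : normedModType R) (mu : set E -> V)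
    (f : E -> R) (v : V) (N : nat) (s : nat -> {sfun E >-> R}) :
  is_vintegral_space mu f v ->
  {uniform setT, (fun n => s n : E -> R) @ \oo --> f} ->
  (forall n y, ~ euclidean_ball N%:R y -> s n y = 0) ->
  vsintegral mu (euclidean_ball N%:R) (s n) @[n --> \oo] --> v.
Proof.
move=> [I muI Iv] sf s0.
have IE M : (N <= M)%N ->
    vsintegral mu (euclidean_ball N%:R) (s n) @[n --> \oo] --> I M.
  move=> NM.
  have sfM : {uniform @euclidean_ball R d M%:R,
      (fun n => s n : E -> R) @ \oo --> f}.
    by apply: uniform_subset_cvg sf.
  have -> : (fun n => vsintegral mu (euclidean_ball N%:R) (s n)) =
      (fun n => vsintegral mu (euclidean_ball M%:R) (s n)).
    apply/funext => n; apply/esym/vsintegral_support; last exact: s0.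
    by apply: euclidean_ball_subset; rewrite ler_nat.
  exact: muI.
have INM M : (N <= M)%N -> I M = I N.
  move=> NM; apply: (cvg_unique (@norm_hausdorff _ V) (IE M NM)).
  exact: IE.
suff -> : v = I N by exact: IE.
apply: (cvg_unique (@norm_hausdorff _ V) Iv).
by apply: cvg_near_cst; exists N => // M /= NM; exact: INM.
Qed.

(** The series with all terms equal to [mu set0] converges. *)
Lemma vsigma_additive0 (V : normedModType R) (mu : set E -> V) :
  vsigma_additive mu -> mu set0 = 0.
Proof.
move=> mu_sa; have b0 : @bounded_borel R d set0.
  by split=> //; exists 0; split=> // x _ y.
have := mu_sa (fun=> set0) (fun=> b0) (@trivIset_set0 _ _ _).
rewrite bigcup0// => /(_ b0) cv.
have c0 : mu set0 @[_ --> \oo] --> (0 : V).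
  by apply: (@cvg_series_cvg_0 _ _ (fun=> mu set0)); apply/cvg_ex; eexists; exact: cv.
by apply: (cvg_unique (@norm_hausdorff _ V) _ c0); exact: cvg_cst.
Qed.

End vsintegral_theory.

Section scalar_measure.
Import HBSimple.
Context (R : realType) (d : nat).
Local Notation E := 'rV[R]_d.
Context (lam : set E -> R^o) (lam_sa : vsigma_additive lam).
Context (D : set E) (bD : bounded_borel D).

(** Intersecting with [D] extends a measure on bounded Borel sets to a finite
signed measure on the whole Borel sigma-algebra, to which the Hahn and Jordan
decompositions apply. *)
Definition restricted_charge (A : set E) : \bar R := (lam (A `&` D))%:E.

Let charge0 : restricted_charge set0 = 0%E.
Proof. by rewrite /restricted_charge set0I (vsigma_additive0 lam_sa). Qed.

Let charge_finite A : measurable A -> restricted_charge A \is a fin_num.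
Proof. by []. Qed.

Let charge_sigma_additive : semi_sigma_additive restricted_charge.
Proof.
move=> F mF tF mUF; rewrite /restricted_charge.
have -> : (fun n => \sum_(0 <= i < n) (lam (F i `&` D))%:E)%E =
    EFin \o series (fun n => lam (F n `&` D)).
  by apply/funext => n; rewrite /= /series /= sumEFin.
apply: cvg_EFin; first exact: nearW.
rewrite setI_bigcupl; apply: lam_sa.
- move=> n; apply: (bounded_borel_subset _ _ bD) => //.
  by apply: measurableI => //; case: bD.
- by apply: trivIset_setIr.
- rewrite -setI_bigcupl; apply: (bounded_borel_subset _ _ bD) => //.
  by apply: measurableI => //; case: bD.
Qed.

HB.instance Definition _ := isCharge.Build _ _ _ restricted_charge
  charge0 charge_finite charge_sigma_additive.

(** Integration against a finite measure is an operator dominated by that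
measure, so the results on [operator_measure] hold for it. *)
Let Rint (p : {finite_measure set E -> \bar R}) (f : E -> R) : R^o :=
  \int[p]_y f y.

Let Rint_linear (p : {finite_measure set E -> \bar R}) (a : R) (f g : E -> R) :
  p.-integrable [set: E] (EFin \o f) -> p.-integrable [set: E] (EFin \o g) ->
  Rint p (fun y => a * f y + g y) = a *: Rint p f + Rint p g.
Proof.
move=> intf intg; rewrite /Rint RintegralD ?RintegralZl//.
exact: (integrableZl measurableT a intf).
Qed.

Let le_normr_Rint (p : {finite_measure set E -> \bar R}) (f : E -> R) : p.-integrable [set: E] (EFin \o f) ->
  `|Rint p f| <= \int[p]_y `|f y|.
Proof. exact: le_normr_Rintegral. Qed.

Let finite_bounded_borel (p : {finite_measure set E -> \bar R}) A :
  bounded_borel A -> (p A < +oo)%E.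
Proof. by move=> [mA _]; rewrite ltey_eq fin_num_measure. Qed.

(** The positive and negative parts of [lam] give the bumps of open subsets of
[U0] the same integrals. In the limit they agree on the open subsets of [U0],
which form a pi-system, hence on its Borel subsets. *)
Lemma scalar_measure_eq0 (U0 : set E) : open U0 -> U0 `<=` D ->
  (forall (U : set E) k (s : nat -> {sfun E >-> R}), open U -> U `<=` U0 ->
     {uniform setT, (fun n => s n : E -> R) @ \oo --> open_bump U k} ->
     (forall n y, ~ U y -> s n y = 0) ->
     vsintegral lam D (s n) @[n --> \oo] --> (0 : R^o)) ->
  forall A, measurable A -> A `<=` U0 -> lam A = 0.
Proof.
move=> oU0 U0D lam0 A mA AU0.
have mD : measurable D by case: bD.
have [P [N PN]] := Hahn_decomposition restricted_charge.
pose p : {finite_measure set E -> \bar R} := jordan_pos PN.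
pose q : {finite_measure set E -> \bar R} := jordan_neg PN.
have lamE B : measurable B -> B `<=` D -> lam B = fine (p B) - fine (q B).
  move=> mB BD; apply: EFin_inj; rewrite EFinB !fineK ?fin_num_measure//.
  have -> : (lam B)%:E = restricted_charge B.
    by rewrite /restricted_charge (setIidl BD).
  by rewrite (jordan_decomp PN mB) /cadd /= cscaleN1.
have opE (r : {finite_measure set E -> \bar R}) B : measurable B ->
    operator_measure (Rint r) B = fine (r B).
  by move=> mB; rewrite /operator_measure /Rint /Rintegral integral_indic// setIT.
have vsE s : vsintegral lam D s = vsintegral (operator_measure (Rint p)) D s -
    vsintegral (operator_measure (Rint q)) D s.
  rewrite -vsintegralB; apply: eq_vsintegral => // B mB BD.
  by rewrite lamE// !opE.
have bU U : open U -> U `<=` U0 -> bounded_borel U.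
  move=> oU UU0; apply: (bounded_borel_subset _ _ bD).
    exact: open_measurable_mx.
  exact: subset_trans U0D.
have bumpE U k : open U -> U `<=` U0 -> Rint p (open_bump U k) = Rint q (open_bump U k).
  move=> oU UU0; have [mU bU'] := bU _ oU UU0.
  have mb := measurable_open_bump U k.
  have bD1 y : open_bump U k y * \1_D y = open_bump U k y.
    have [Dy|nDy] := pselect (D y); first by rewrite indicE mem_set// mulr1.
    by rewrite open_bump_eq0 ?mul0r// => /UU0/U0D.
  have b01 y : 0 <= open_bump U k y <= 1 by rewrite open_bump_ge0 open_bump_le1.
  have [s [s0 sb]] := sfun_uniform_approx mb b01.
  have scvg : {uniform setT, (fun n => s n : E -> R) @ \oo --> open_bump U k}.
    apply/uniform_cvgP => e e0; near=> n => y _.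
    apply: (le_lt_trans (sb n y)).
    by near: n; exact: near_infty_natSinv_lt (PosNum e0).
  have sD : {uniform D, (fun n => s n : E -> R) @ \oo --> open_bump U k}.
    by apply: uniform_subset_cvg scvg.
  have s0U n y : ~ U y -> s n y = 0 by move=> nU; apply/s0/open_bump_eq0.
  have cp := is_vintegral_operator_measure (@Rint_linear p) (@le_normr_Rint p)
    (@finite_bounded_borel p) bD mb sD.
  have cq := is_vintegral_operator_measure (@Rint_linear q) (@le_normr_Rint q)
    (@finite_bounded_borel q) bD mb sD.
  have := lam0 U k s oU UU0 scvg s0U.
  under eq_fun do rewrite vsE.
  move=> c0; apply/eqP; rewrite -subr_eq0; apply/eqP.
  have E1 r : Rint r (open_bump U k) = Rint r (fun y => open_bump U k y * \1_D y).
    by congr Rint; apply/funext => y; rewrite bD1.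
  rewrite !E1; apply: (cvg_unique (@norm_hausdorff _ R^o) _ c0).
  exact: cvgB.
have pqU U : open U -> U `<=` U0 -> p U = q U.
  move=> oU UU0; have [mU bU'] := bU _ oU UU0.
  have mb k := measurable_open_bump U k.
  have cvgr (r : {finite_measure set E -> \bar R}) :
      Rint r (open_bump U k) @[k --> \oo] --> Rint r \1_U.
    apply: (operator_dominated_cvg (@Rint_linear r) (@le_normr_Rint r) (g := fun=> 1)).
    - exact: mb.
    - exact: measurable_indic.
    - exact: finite_measure_integrable_cst.
    - by move=> y; exact: open_bump_cvg.
    - by move=> k y; rewrite ger0_norm ?open_bump_ge0// open_bump_le1.
  have cvgp := cvgr p; have cvgq := cvgr q.
  have E1 : (fun k => Rint p (open_bump U k)) = (fun k => Rint q (open_bump U k)).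
    by apply/funext => k; exact: bumpE.
  rewrite E1 in cvgp.
  have := cvg_unique (@norm_hausdorff _ R^o) cvgp cvgq.
  rewrite -[Rint p _]/(operator_measure (Rint p) U).
  rewrite -[Rint q _]/(operator_measure (Rint q) U) !opE// => pq.
  by rewrite -[p U]fineK ?fin_num_measure// pq fineK// fin_num_measure.
have mU0 : measurable U0 by exact: open_measurable_mx.
have pqA : mrestr p mU0 A = mrestr q mU0 A.
  apply: (measure_unique (@open E) (fun=> setT)) => //.
  - by move=> X Y oX oY; exact: openI.
  - by move=> _; exact: openT.
  - by rewrite bigcup_const//; exists 0%N.
  - move=> X oX; rewrite /= /mrestr; apply: pqU; last exact: subIsetr.
    exact: openI.
  - by move=> _; rewrite /= /mrestr setTI ltey_eq fin_num_measure.
rewrite lamE//; last exact: subset_trans U0D.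
by move: pqA; rewrite /mrestr (setIidl AU0) => ->; rewrite subrr.
Unshelve. all: by end_near. Qed.

End scalar_measure.

Section L1_vector_measure_uniqueness.
Import HBSimple.
Context (R : realType) (d : nat).
Context disp (Omega : measurableType disp) (P : {measure set Omega -> \bar R}).
Local Notation E := 'rV[R]_d.

(** These functionals separate the points of L^1(P), so the uniqueness of vector
measures reduces to that of real ones. *)
Definition L1_pairing (A : set Omega) (u : L1 P) : R^o := \int[P]_(w in A) u w.

Lemma L1_pairing_linear A : measurable A -> linear (L1_pairing A).
Proof.
move=> mA a u v.
have iA (w : L1 P) : P.-integrable A (EFin \o w).
  exact: (integrableS measurableT mA _ (integrable_L1_fun w)).
transitivity (\int[P]_(w in A) (a * u w + v w)); last first.
  have iau : P.-integrable A (EFin \o (fun w => a * u w)).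
    exact: (integrableZl mA a (iA u)).
  rewrite (RintegralD mA iau (iA v)) (RintegralZl _ mA (iA u))//.
rewrite /L1_pairing /Rintegral; congr fine; apply: ae_eq_integral => //.
- exact: (measurable_int _ (iA _)).
- exact: (measurable_int _ (integrableD mA (integrableZl mA a (iA u)) (iA v))).
have := L1_funD (a *: u) v; have := L1_funZ a u.
by apply: filterS2 => w auE avE _; rewrite avE// auE.
Qed.

Lemma le_normr_L1_pairing A u : measurable A -> `|L1_pairing A u| <= `|u|.
Proof.
move=> mA; have iu := integrable_L1_fun u.
have iA : P.-integrable A (EFin \o u) by exact: (integrableS measurableT mA _ iu).
apply: (le_trans (le_normr_Rintegral mA iA)).
rewrite normr_L1E; apply: fine_le.
- exact: (integrable_fin_num _ (integrable_norm iA)).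
- exact: (integrable_fin_num _ (integrable_norm iu)).
apply: ge0_subset_integral => //.
exact: (measurable_int _ (integrable_norm iu)).
Qed.

Lemma L1_pairing_eq0 u : (forall A, measurable A -> L1_pairing A u = 0) -> u = 0.
Proof.
move=> u0; apply/L1P; apply: ae_eq_trans (ae_eq_sym (L1_fun0 P)).
have iu := integrable_L1_fun u.
have : ae_eq P setT (EFin \o u) (cst 0%E).
  apply: (integral_ae_eq measurableT iu); first exact: measurable_cst.
  move=> A _ mA; rewrite integral0; transitivity (L1_pairing A u)%:E.
    rewrite fineK//; apply: integrable_fin_num => //.
    exact: (integrableS measurableT mA _ iu).
  by rewrite u0.
by apply: filterS => w /= uw wT; have [] := uw wT.
Qed.

Lemma L1_pairing_cvg A (u_ : nat -> L1 P) u : measurable A ->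
  u_ n @[n --> \oo] --> u -> L1_pairing A (u_ n) @[n --> \oo] --> L1_pairing A u.
Proof.
move=> mA /cvgrPdist_lt uu; apply/cvgrPdist_lt => e /uu; apply: filterS => n.
apply: le_lt_trans.
have -> : L1_pairing A u - L1_pairing A (u_ n) = L1_pairing A (u - u_ n).
  by rewrite addrC -scaleN1r -(L1_pairing_linear mA) scaleN1r addrC.
exact: le_normr_L1_pairing.
Qed.

(** Every bounded set lies in an open ball for the maximum norm, itself inside
some [euclidean_ball N]; the bumps on open subsets of the former belong to CL and
vanish outside the latter. *)
Lemma L1_vector_measure_unique (nu mu : set E -> L1 P) :
  vsigma_additive nu -> vsigma_additive mu ->
  (forall f : CL R d, exists2 v, is_vintegral_space nu f v &
    is_vintegral_space mu f v) ->
  forall A, bounded_borel A -> nu A = mu A.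
Proof.
move=> nu_sa mu_sa numu A [mA [M [Mr bA]]].
pose c := `|M| + 1; pose U0 : set E := [set y | `|y| < c].
have c0 : 0 < c by rewrite ltr_wpDl.
have oU0 : open U0.
  rewrite (_ : U0 = ball (0 : E) c); first exact: ball_open.
  by rewrite -ball_normE; apply/seteqP; split=> y; rewrite /U0 /= sub0r normrN.
pose N := (Num.truncn (d%:R * c)).+1.
have U0D : U0 `<=` euclidean_ball N%:R.
  by apply: ball0_subset_euclidean_ball; rewrite ltW// truncnS_gt.
have bD := euclidean_ball_bounded_borel d (N%:R : R).
(* |M| + 1/2 is an admissible bound on A, and is smaller than the radius c *)
have AU0 : A `<=` U0.
  move=> y Ay; apply: (@le_lt_trans _ _ (`|M| + 2^-1)); last first.
    by rewrite ltrD2l invf_lt1// ltr1n.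
  by apply: bA => //; rewrite (le_lt_trans (ler_norm M))// ltrDl.
apply/eqP; rewrite -subr_eq0; apply/eqP/L1_pairing_eq0 => X mX.
pose lam B := L1_pairing X (nu B - mu B).
rewrite -/(lam A); apply: (scalar_measure_eq0 _ bD oU0 U0D) => //.
  move=> F bF tF bUF.
  have -> : series (fun n => lam (F n)) = (fun n => L1_pairing X
      (series (fun n => nu (F n)) n - series (fun n => mu (F n)) n)).
    apply/funext => n; rewrite /series /= -sumrB.
    elim: n => [|n IH].
      rewrite !big_nil; have := L1_pairing_linear mX 1 0 0.
      rewrite scaler0 addr0 scale1r => /(congr1 (fun v => v - L1_pairing X 0)).
      by rewrite subrr addrK.
    rewrite !big_nat_recr//= IH /lam addrC [in RHS]addrC.
    by rewrite -[in RHS](scale1r (nu _ - mu _)) L1_pairing_linear// scale1r.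
  apply: L1_pairing_cvg => //.
  by apply: cvgB; [exact: nu_sa|exact: mu_sa].
move=> U k s oU UU0 sU s0.
have bU : bounded_set U.
  by apply: (bounded_borel_subset _ (subset_trans UU0 U0D) bD).2;
    exact: open_measurable_mx.
have [v nuv muv] := numu (MkCL (open_bump_CL oU bU k)).
have sD n y : ~ euclidean_ball N%:R y -> s n y = 0.
  by move=> nDy; apply: s0 => /UU0/U0D.
have nus := is_vintegral_space_support nuv sU sD.
have mus := is_vintegral_space_support muv sU sD.
have -> : (fun n => vsintegral lam (euclidean_ball N%:R) (s n)) =
    (fun n => L1_pairing X (vsintegral nu (euclidean_ball N%:R) (s n) -
                            vsintegral mu (euclidean_ball N%:R) (s n))).
  apply/funext => n; rewrite -vsintegralB.
  by rewrite (vsintegral_linear _ _ _ (L1_pairing_linear mX)).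
have -> : (0 : R^o) = L1_pairing X (v - v).
  rewrite subrr; apply/esym/eqP; rewrite -normr_le0.
  by rewrite (le_trans (le_normr_L1_pairing _ mX))// normr0.
by apply: L1_pairing_cvg => //; exact: cvgB.
Qed.

End L1_vector_measure_uniqueness.

(** * Joint measurability *)

Section joint_measurability.
Context (R : realType) d (T : measurableType d).
Local Notation RT := (measurableTypeR R).

(** By induction on the dimension, since [cons_rV] is measurable. *)
Lemma measurable_rV n (f : T -> 'rV[R]_n) :
  (forall i, measurable_fun setT (fun z => f z ord0 i)) -> measurable_fun setT f.
Proof.
elim: n f => [|n IH] f mf.
  have -> : f = cst 0 by apply/funext => z; apply/rowP => -[].
  exact: measurable_cst.
pose g z := (f z ord0 ord0, \row_j f z ord0 (lift ord0 j)).
have -> : f = @cons_rV R n \o g.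
  apply/funext => z; apply/rowP => i; rewrite !mxE /=.
  by case: unliftP => [j ->|->] //=; rewrite mxE.
apply: measurableT_comp; first exact: measurable_cons_rV.
apply: measurable_fun_pair => /=; first exact: mf.
apply: IH => j; have := mf (lift ord0 j).
by under [X in _ -> measurable_fun _ X]eq_fun do rewrite mxE.
Qed.

(** A process with continuous paths is the limit of the processes frozen on the
time grid of step [1 / (n + 1)], which are jointly measurable because they take
countably many forms. Truncating times at 0 makes the integer part, which is 0
on negative numbers, converge for every real time. *)
Lemma continuous_paths_jointly_measurable (b : R -> T -> R) :
  (forall t, 0 <= t -> measurable_fun setT (b t)) ->
  (forall w, continuous (fun t : R => b (Num.max 0 t) w)) ->
  measurable_fun [set: T * RT] (fun z => b (Num.max 0 z.2) z.1).
Proof.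
move=> mb cb.
pose k n (t : R) := Num.truncn (t * n.+1%:R).
have mle n i : measurable ([set t | (k n t <= i)%N] : set RT).
  have mkn : measurable_fun [set: RT] (fun t : RT => t * n.+1%:R).
    by apply: measurable_funM.
  have := mkn measurableT _ (measurable_itv `]-oo, i.+1%:R[).
  by congr measurable; apply/seteqP; split=> t /=;
    rewrite in_itv/= truncn_le_nat => // -[].
have mk n i : measurable ([set t | k n t = i] : set RT).
  case: i => [|i].
    have := mle n 0%N; congr measurable.
    by apply/seteqP; split=> t /=; rewrite leqn0 => /eqP.
  have := measurableD (mle n i.+1) (mle n i); congr measurable.
  apply/seteqP; split=> t /=.
    by move=> [ki1 /negP]; rewrite -ltnNge => ik; apply/eqP; rewrite eqn_leq ki1.
  by move=> ->; split=> //; apply/negP; rewrite ltnn.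
pose bn n (z : T * RT) : R := b ((k n z.2)%:R / n.+1%:R) z.1.
apply: (@measurable_fun_cvg _ _ _ _ bn) => [n|[w t] _].
  move=> _ Y mY; rewrite setTI.
  have -> : bn n @^-1` Y = \bigcup_i
      ((b (i%:R / n.+1%:R) @^-1` Y) `*` [set t : RT | k n t = i]).
    apply/seteqP; split=> [[w t] Yb|[w t] [i _ [/= Yb kt]]].
      by exists (k n t).
    by rewrite /bn /= kt.
  apply: bigcup_measurable => i _; apply: measurableX => //.
  by rewrite -[X in measurable X]setTI; apply: mb.
have kt : (k n t)%:R / n.+1%:R @[n --> \oo] --> Num.max 0 t.
  have [t0|t0] := leP 0 t.
    apply/cvgrPdist_lt => e e0; near=> n.
    have n0 : 0 < n.+1%:R :> R by [].
    have /truncn_itv/andP[k1 k2] : 0 <= t * n.+1%:R by rewrite mulr_ge0.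
    rewrite -[X in `|X - _|](mulfK (lt0r_neq0 n0)) -mulrBl.
    rewrite normrM [X in _ * X]ger0_norm ?invr_ge0//.
    apply: (@le_lt_trans _ _ n.+1%:R^-1); last first.
      by near: n; exact: near_infty_natSinv_lt (PosNum e0).
    rewrite ler_piMl ?invr_ge0//.
    by rewrite ger0_norm ?subr_ge0// lerBlDr addrC natr1 ltW.
  apply: cvg_near_cst; apply: nearW => n.
  suff -> : k n t = 0%N by rewrite mul0r.
  apply/eqP; rewrite -leqn0 truncn_le_nat.
  by rewrite (@lt_trans _ _ 0)// pmulr_llt0.
have max_k n : (k n t)%:R / n.+1%:R = Num.max 0 ((k n t)%:R / n.+1%:R) :> R.
  by rewrite max_r.
rewrite /bn /=; under eq_fun do rewrite max_k.
have -> : Num.max 0 t = Num.max 0 (Num.max 0 t) :> R by rewrite maxA maxxx.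
apply: (cvg_comp (fun n => (k n t)%:R / n.+1%:R) (fun s => b (Num.max 0 s) w) kt).
exact: cb.
Unshelve. all: by end_near. Qed.

End joint_measurability.

(** * Occupation measure and integration along the path *)

Lemma ge0_integral_mrestr d (T : measurableType d) (R : realType)
    (mu : {measure set T -> \bar R}) (D : set T) (mD : measurable D)
    (f : T -> \bar R) : measurable_fun setT f -> (forall y, 0 <= f y)%E ->
  (\int[mrestr mu mD]_y f y = \int[mu]_(y in D) f y)%E.
Proof.
move=> mf f0; have mDC : measurable (~` D) by exact: measurableC.
have mu0 : mrestr mu mD (~` D) = 0%E by rewrite /mrestr setICl measure0.
rewrite (ge0_negligible_integral mDC measurableT mf (fun y _ => f0 y) mu0).
rewrite setTD setCK; apply: eq_measure_integral => A mA AD.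
by rewrite /= /mrestr (setIidl AD).
Qed.

Section occupation_operator.
Context (R : realType) (d : nat) disp (Omega : measurableType disp).
Context (P : probability Omega R).
Local Notation E := 'rV[R]_d.
Local Notation RT := (measurableTypeR R).
Local Notation leb := (@lebesgue_measure R).
Local Notation lebd := (lebesgue_rV R d).
Local Notation Plebt := (P \x leb)%E.
Context (beta : {mfun (Omega * RT)%type >-> E}).
Hypothesis law_beta : forall (t : R) (A : set E), 1 <= t -> measurable A ->
  (P ((fun w => beta (w, t)) @^-1` A) <= (decay t)%:E * lebd A)%E.

Let mbeta : measurable_fun setT beta. Proof. exact: measurable_funPT. Qed.

Let measurable_beta_t (t : RT) : measurable_fun setT (fun w => beta (w, t)).
Proof. exact: (measurableT_comp mbeta (pair2_measurable t)). Qed.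

Let decay_nng (t : R) : {nonneg R} := NngNum (decay_ge0 t).

(** The law of [beta (., t)] is at most [decay t] times Lebesgue measure as a
measure, hence also on nonnegative functions. *)
Lemma expectation_le_decay (t : R) (h : E -> \bar R) : 1 <= t ->
  measurable_fun setT h -> (forall y, 0 <= h y)%E ->
  (\int[P]_w h (beta (w, t)) <= (decay t)%:E * \int[lebd]_y h y)%E.
Proof.
move=> t1 mh h0; have mbt := measurable_beta_t t.
have -> : (\int[P]_w h (beta (w, t)) =
    \int[pushforward P (fun w => beta (w, t))]_y h y)%E.
  by rewrite ge0_integral_pushforward.
rewrite -[X in (X * _)%E]/((decay_nng t)%:num%:E) -ge0_integral_mscale//.
by apply: ge0_le_measure_integral => // A mA; exact: law_beta.
Qed.

(** Tonelli, with the time integral outside: at time [t] the expectation is at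
most [decay t] times the Lebesgue integral, and the integral of [decay] over the
times beyond [a] is [2 / sqrt a]. *)
Lemma integral_occupation_tail (a : R) (h : E -> \bar R) : 1 <= a ->
  measurable_fun setT h -> (forall y, 0 <= h y)%E ->
  (\int[Plebt]_z (h (beta z) * (\1_`[a, +oo[ z.2)%:E) <=
   (2 / Num.sqrt a)%:E * \int[lebd]_y h y)%E.
Proof.
move=> a1 mh h0.
have mI : measurable_fun [set: Omega * RT] (fun z => (\1_`[a, +oo[ z.2 : R)%:E).
  apply/measurable_EFinP; apply: (measurableT_comp _ measurable_snd).
  exact: measurable_indic.
have mf : measurable_fun [set: Omega * RT]
    (fun z => h (beta z) * (\1_`[a, +oo[ z.2)%:E)%E.
  by apply: emeasurable_funM => //; exact: measurableT_comp.
have f0 z : (0 <= h (beta z) * (\1_`[a, +oo[ z.2)%:E)%E.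
  by rewrite mule_ge0// lee_fin.
rewrite (fubini_tonelli2 _ mf f0) /fubini_G /= -(integral_decay a1).
have I0 : (0 <= \int[lebd]_y h y)%E by exact: integral_ge0.
have mdecay : measurable_fun (`[a, +oo[ : set RT) (EFin \o @decay R).
  by apply/measurable_EFinP; apply: measurable_decay; exact: lt_le_trans a1.
rewrite -ge0_integralZr//; last first.
- by move=> t _; rewrite lee_fin decay_ge0.
rewrite [leRHS]integral_mkcond; apply: ge0_le_integral => //.
- by move=> t _; exact: integral_ge0.
- exact: (measurable_fun_fubini_tonelli_G _ mf).
- by apply/(measurable_restrictT _ _).1 => //; exact: emeasurable_funM.
move=> t _; rewrite /patch indicE; case: ifPn => [/set_mem|_].
  rewrite /= in_itv/= andbT => at_.
  under eq_integral do rewrite mule1.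
  by apply: expectation_le_decay => //; exact: le_trans at_.
by under eq_integral do rewrite mule0; rewrite integral0.
Qed.

(** The kernel bound is not integrable at time 0, where the supremum of [h]
is used instead. *)
Lemma integral_occupation_head (c : R) (h : E -> \bar R) :
  measurable_fun setT h -> (forall y, 0 <= h y <= c%:E)%E ->
  (\int[Plebt]_z (h (beta z) * (\1_`[0%R, 1%R[ z.2)%:E) <= c%:E)%E.
Proof.
move=> mh hc; have h0 y : (0 <= h y)%E by case/andP: (hc y).
have mI : measurable_fun [set: Omega * RT] (fun z => (\1_`[0%R, 1%R[ z.2 : R)%:E).
  apply/measurable_EFinP; apply: (measurableT_comp _ measurable_snd).
  exact: measurable_indic.
have mf : measurable_fun [set: Omega * RT]
    (fun z => h (beta z) * (\1_`[0%R, 1%R[ z.2)%:E)%E.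
  by apply: emeasurable_funM => //; exact: measurableT_comp.
have mind : measurable_fun [set: Omega * RT]
    (fun z => (\1_(setT `*` `[0%R, 1%R[) z : R)%:E).
  by apply/measurable_EFinP; apply: measurable_indic; exact: measurableX.
have c0 : (0 <= c%:E)%E by case/andP: (hc 0) => /le_trans; apply.
apply: (@le_trans _ _ (\int[Plebt]_z (c%:E * (\1_(setT `*` `[0%R, 1%R[) z)%:E))%E).
  apply: ge0_le_integral => //.
  - by move=> z _; rewrite mule_ge0// lee_fin.
  - exact: measurable_funeM.
  move=> [w t] _ /=; rewrite !indicE in_setX/= in_setT/= lee_pmul// ?lee_fin//.
  by case/andP: (hc (beta (w, t))).
rewrite ge0_integralZl//.
rewrite integral_indic ?setIT//; last exact: measurableX.
have m01 : measurable (`[0%R, 1%R[ : set RT) by exact: measurable_itv.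
apply: (@le_trans _ _ (c%:E * 1)%E); last by rewrite mule1.
apply: lee_pmul => //; rewrite le_eqVlt; apply/orP; left; apply/eqP.
transitivity (P setT * leb `[0%R, 1%R[)%E; first exact: product_measure1E.
rewrite probability_setT mul1e lebesgue_measure_itv/= lte_fin ltr01.
by rewrite oppr0 adde0.
Qed.

Let half_line : set RT := `[0, +oo[%classic.

Let mH : measurable ([set: Omega] `*` half_line).
Proof. by apply: measurableX => //; exact: measurable_itv. Qed.

Definition occupation_measure : set E -> \bar R :=
  pushforward (mrestr Plebt mH) beta.

Let occupation_measure0 : occupation_measure set0 = 0%E.
Proof. by rewrite /occupation_measure /pushforward preimage_set0 measure0. Qed.

Let measurable_preimage_beta (A : set E) : measurable A ->
  measurable (beta @^-1` A).
Proof. by move=> mA; rewrite -[X in measurable X]setTI; exact: mbeta. Qed.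

Let occupation_measure_ge0 A : (0 <= occupation_measure A)%E.
Proof. exact: (measure_ge0 (mrestr Plebt mH)). Qed.

Let occupation_measure_sigma_additive : semi_sigma_additive occupation_measure.
Proof.
move=> F mF tF mUF; rewrite /occupation_measure /pushforward preimage_bigcup.
apply: (@measure_semi_sigma_additive _ _ _ (mrestr Plebt mH)).
- by move=> i; exact: measurable_preimage_beta.
- apply/trivIsetP => /= i j _ _ ij; rewrite -preimage_setI.
  by move/trivIsetP : tF => /(_ _ _ _ _ ij) ->//; rewrite preimage_set0.
- by rewrite -preimage_bigcup; exact: measurable_preimage_beta.
Qed.

HB.instance Definition _ := isMeasure.Build _ _ _ occupation_measure
  occupation_measure0 occupation_measure_ge0 occupation_measure_sigma_additive.

Local Notation G := occupation_measure.

Lemma integral_occupation (h : E -> \bar R) :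
  measurable_fun setT h -> (forall y, 0 <= h y)%E ->
  (\int[G]_y h y = \int[Plebt]_z (h (beta z) * (\1_half_line z.2)%:E))%E.
Proof.
move=> mh h0; have mhb : measurable_fun setT (h \o beta).
  exact: measurableT_comp.
transitivity (\int[mrestr Plebt mH]_z h (beta z))%E.
  by rewrite ge0_integral_pushforward// => y _; exact: h0.
rewrite ge0_integral_mrestr//.
rewrite integral_mkcond; apply: eq_integral => -[w t] _.
rewrite /patch indicE in_setX/= in_setT/=.
by case: ifP => _; rewrite ?mule1 ?mule0.
Qed.

(** The estimate that makes everything finite: time is split at 1. *)
Lemma integral_occupation_le (c : R) (h : E -> \bar R) :
  measurable_fun setT h -> (forall y, 0 <= h y <= c%:E)%E ->
  (\int[G]_y h y <= c%:E + 2%:E * \int[lebd]_y h y)%E.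
Proof.
move=> mh hc; have h0 y : (0 <= h y)%E by case/andP: (hc y).
have mI (D : set RT) : measurable D ->
    measurable_fun [set: Omega * RT] (fun z => h (beta z) * (\1_D z.2)%:E)%E.
  move=> mD; apply: emeasurable_funM; first exact: measurableT_comp.
  apply/measurable_EFinP; apply: (measurableT_comp _ measurable_snd).
  exact: measurable_indic.
have I0 (D : set RT) z : (0 <= h (beta z) * (\1_D z.2)%:E)%E.
  by rewrite mule_ge0// lee_fin.
rewrite integral_occupation//.
have -> : (fun z => h (beta z) * (\1_half_line z.2)%:E)%E =
  (fun z => h (beta z) * (\1_(`[0%R, 1%R[ : set RT) z.2)%:E +
            h (beta z) * (\1_(`[1%R, +oo[ : set RT) z.2)%:E)%E.
  apply/funext => -[w t] /=; rewrite -ge0_muleDr ?lee_fin// -EFinD.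
  congr (_ * _%:E)%E; rewrite !indicE /half_line !mem_setE !in_itv/= !andbT.
  have [t1|t1] := ltP t 1; first by rewrite andbT addr0.
  by rewrite andbF add0r (le_trans ler01 t1).
rewrite ge0_integralD//; [|exact: mI..].
apply: leeD; first exact: integral_occupation_head.
have := integral_occupation_tail (lexx 1) mh h0.
by rewrite sqrtr1 divr1.
Qed.

Lemma occupation_bounded_borel A : bounded_borel A -> (G A < +oo)%E.
Proof.
move=> bA; have mA : measurable A by case: bA.
have mh : measurable_fun [set: E] (fun y => (\1_A y : R)%:E).
  exact/measurable_EFinP.
have hc y : (0 <= (\1_A y : R)%:E <= 1%:E)%E.
  by rewrite !lee_fin indicE; case: (_ \in _); rewrite ?lexx ?ler01.
have := integral_occupation_le mh hc; rewrite !integral_indic// !setIT.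
move=> /le_lt_trans; apply; rewrite lte_add_pinfty ?ltry//.
by rewrite lte_mul_pinfty// lebesgue_rV_bounded_borel.
Qed.

Lemma CL_occupation_integrable (f : CL R d) : G.-integrable [set: E] (EFin \o f).
Proof.
have mf : measurable_fun [set: E] f.
  by apply: continuous_measurable_mx; exact: CL_continuous.
have [M [Mr fM]] := CL_bounded f.
apply/integrableP; split; first exact/measurable_EFinP.
have mh : measurable_fun [set: E] (fun y => `|(EFin \o f) y|)%E.
  by apply: measurableT_comp => //; exact/measurable_EFinP.
have hc y : (0 <= `|(EFin \o f) y| <= (`|M| + 1)%:E)%E.
  rewrite abse_ge0 /= lee_fin; apply: fM => //.
  by rewrite (le_lt_trans (ler_norm M))// ltrDl.
apply: (le_lt_trans (integral_occupation_le mh hc)).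
rewrite lte_add_pinfty ?ltry// lte_mul_pinfty//.
by have /integrableP[] := CL_integrable f.
Qed.

Definition occupation_operator (D : set RT) (h : E -> R) : L1 P :=
  fiber_integral P leb (fun z => h (beta z) * \1_D z.2).

Lemma integrable_occupation (D : set RT) (h : E -> R) :
  measurable D -> D `<=` half_line -> G.-integrable [set: E] (EFin \o h) ->
  Plebt.-integrable [set: Omega * RT]
    (EFin \o (fun z => h (beta z) * \1_D z.2)).
Proof.
move=> mD DH inth; have mh := measurable_int _ inth.
have mhb : measurable_fun setT (h \o beta).
  by apply: measurableT_comp => //; exact/measurable_EFinP.
have mI (D' : set RT) : measurable D' ->
    measurable_fun [set: Omega * RT] (fun z => \1_D' z.2 : R).
  move=> mD'; apply: (measurableT_comp _ measurable_snd).
  exact: measurable_indic.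
apply/integrableP; split.
  by apply/measurable_EFinP; apply: measurable_funM => //; exact: mI.
have /integrableP[_] := inth; apply: le_lt_trans.
rewrite integral_occupation//; last exact: measurableT_comp.
have mHl : measurable half_line by exact: measurable_itv.
apply: ge0_le_integral => //.
- do 2 apply: measurableT_comp => //.
  by apply: measurable_funM => //; exact: mI.
- apply: emeasurable_funM; last by apply/measurable_EFinP; exact: mI.
  exact: (measurableT_comp (measurable_int _ (integrable_norm inth)) mbeta).
move=> -[w t] _ /=; rewrite normrM EFinM lee_pmul// lee_fin [leLHS]ger0_norm//.
rewrite !indicE ler_nat; case: (boolP (t \in D)) => // /set_mem /DH tH.
by rewrite mem_set.
Qed.

Lemma occupation_operator_linear D (a : R) (f g : E -> R) :
  measurable D -> D `<=` half_line ->
  G.-integrable [set: E] (EFin \o f) -> G.-integrable [set: E] (EFin \o g) ->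
  occupation_operator D (fun y => a * f y + g y) =
  a *: occupation_operator D f + occupation_operator D g.
Proof.
move=> mD DH intf intg; rewrite -fiber_integral_linear; last 2 first.
- exact: integrable_occupation.
- exact: integrable_occupation.
by congr fiber_integral; apply/funext => z; rewrite mulrDl mulrA.
Qed.

(** By the contraction property of fibre integration; so the occupation measure
dominates the operator. *)
Lemma le_normr_occupation_operator (h : E -> R) :
  G.-integrable [set: E] (EFin \o h) ->
  `|occupation_operator half_line h| <= \int[G]_y `|h y|.
Proof.
move=> inth.
have mHl : measurable half_line by exact: measurable_itv.
have intf := integrable_occupation mHl (@subset_refl _ _) inth.
apply: (le_trans (le_normr_fiber_integral intf)).
rewrite le_eqVlt; apply/orP; left; apply/eqP; congr fine.
rewrite (integral_occupation (h := fun y => (`|h y|)%:E))//.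
  by apply: eq_integral => z _; rewrite normrM EFinM [X in (_ * X%:E)%E]ger0_norm.
exact: (measurable_int _ (integrable_norm inth)).
Qed.

Lemma le_normr_occupation_CL (f : CL R d) :
  `|occupation_operator half_line f| <= 2 * `|f|.
Proof.
have intf := CL_occupation_integrable f.
apply: (le_trans (le_normr_occupation_operator intf)).
rewrite CL_normE; set S := (X in sup X); set I := \int[lebd]_y `|f y|.
have ubS : has_ubound S.
  have [M [Mr fM]] := CL_bounded f.
  exists (`|M| + 1) => _ [y _ <-]; apply: fM => //.
  by rewrite (le_lt_trans (ler_norm M))// ltrDl.
have hc y : (0 <= (`|f y|)%:E <= (sup S)%:E)%E.
  by rewrite !lee_fin normr_ge0/=; apply: ub_le_sup => //; exists y.
have S0 : 0 <= sup S by have := hc 0; rewrite !lee_fin => /andP[]; exact: le_trans.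
have mh : measurable_fun [set: E] (fun y => (`|f y|)%:E).
  exact: (measurable_int _ (integrable_norm intf)).
have IE : (\int[lebd]_y (`|f y|)%:E = I%:E)%E.
  rewrite /I /Rintegral fineK//.
  exact: (integrable_fin_num _ (integrable_norm (CL_integrable f))).
apply: (@le_trans _ _ (sup S + 2 * I)).
  rewrite -lee_fin fineK; last exact: (integrable_fin_num _ (integrable_norm intf)).
  by have := integral_occupation_le mh hc; rewrite IE -EFinM -EFinD.
by rewrite mulrDr lerD2r ler_peMl// ler1n.
Qed.

(** The difference is the fibre integral over the times beyond [a]. *)
Lemma occupation_operator_tail (a : R) (h : E -> R) : 1 <= a ->
  G.-integrable [set: E] (EFin \o h) -> lebd.-integrable [set: E] (EFin \o h) ->
  `|occupation_operator half_line h - occupation_operator `[0, a] h| <=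
  2 / Num.sqrt a * \int[lebd]_y `|h y|.
Proof.
move=> a1 intG intl.
have mHl : measurable half_line by exact: measurable_itv.
have m0a : measurable (`[0%R, a] : set RT) by exact: measurable_itv.
have sub0a : (`[0%R, a] : set RT) `<=` half_line.
  by move=> t; rewrite /half_line /= !in_itv/= => /andP[->].
have intF := integrable_occupation mHl (@subset_refl _ _) intG.
have intFa := integrable_occupation m0a sub0a intG.
set F := (fun z => _) in intF; set Fa := (fun z => _) in intFa.
have -> : occupation_operator half_line h - occupation_operator `[0, a] h =
    fiber_integral P leb (fun z => -1 * Fa z + F z).
  by rewrite fiber_integral_linear// scaleN1r addrC.
have intFB : Plebt.-integrable setT (EFin \o (fun z => -1 * Fa z + F z)).
  apply: (eq_integrable _ (fun z => (-1)%:E * (Fa z)%:E + (F z)%:E)%E) => //.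
  by apply: integrableD => //; exact: integrableZl.
apply: (le_trans (le_normr_fiber_integral intFB)).
have mh : measurable_fun [set: E] (fun y => (`|h y|)%:E).
  exact: (measurable_int _ (integrable_norm intl)).
rewrite -lee_fin EFinM fineK; last first.
  exact: (integrable_fin_num _ (integrable_norm intFB)).
rewrite fineK; last exact: (integrable_fin_num _ (integrable_norm intl)).
have h0 y : (0 <= (`|h y|)%:E)%E by rewrite lee_fin.
apply: le_trans (integral_occupation_tail a1 mh h0).
have mI : measurable_fun [set: Omega * RT] (fun z => (\1_`[a, +oo[ z.2 : R)%:E).
  apply/measurable_EFinP; apply: (measurableT_comp _ measurable_snd).
  exact: measurable_indic.
apply: ge0_le_integral => //.
- exact: (measurable_int _ (integrable_norm intFB)).
- by apply: emeasurable_funM => //; exact: (measurableT_comp mh mbeta).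
move=> -[w t] _; rewrite -EFinM lee_fin /F /Fa mulN1r addrC -mulrBr normrM.
rewrite ler_wpM2l// !indicE /half_line /= !mem_setE !in_itv/= !andbT.
have [t0|t0] := leP 0 t; last first.
  by rewrite subr0 normr0.
have [ta|ta] := leP t a; first by rewrite subrr normr0.
by rewrite subr0 normr1 (ltW ta).
Qed.

End occupation_operator.

(** * A jointly measurable version of Brownian motion *)

Section brownian_occupation.
Context (R : realType) (d : nat) disp (Omega : measurableType disp).
Context (P : probability Omega R).
Local Notation E := 'rV[R]_d.
Local Notation RT := (measurableTypeR R).

Lemma measurable_heat_kernel (t : R) : measurable_fun [set: E] (heat_kernel t).
Proof.
apply: measurable_prod => i _.
exact: (measurableT_comp (@measurable_normal_pdf R 0 _) (measurable_coord i)).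
Qed.

(** On a null event [N] containing the paths that are discontinuous or do not
start at [x], the process is replaced by the constant [x]; elsewhere [beta]
extends the path by its starting point to negative times. The laws are bounded
because off [N] the position at time [t] is [x] plus the increment from time 0,
whose density is the heat kernel, and Lebesgue measure is translation
invariant. *)
Lemma brownian_jointly_measurable_version (x : E) (B : R -> Omega -> E) :
  (3 <= d)%N -> brownian_motion P B x ->
  exists (N : set Omega) (beta : {mfun (Omega * RT)%type >-> E}),
    [/\ measurable N, P N = 0%E,
        forall w t, ~ N w -> 0 <= t -> beta (w, t) = B t w &
        forall (t : R) (A : set E), 1 <= t -> measurable A ->
          (P ((fun w => beta (w, t)) @^-1` A) <=
            (decay t)%:E * lebesgue_rV R d A)%E].
Proof.
move=> d3 [mB Bx _ law contB].
have [N [mN PN QN]] := filterI Bx contB.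
have goodN w : ~ N w ->
    B 0 w = x /\ {within `[0, +oo[, continuous (fun t => B t w)}.
  by move=> nNw; apply: contrapT => nQ; apply/nNw/QN.
pose b t w := if w \in N then x else B t w.
pose beta (z : Omega * RT) := b (Num.max 0 z.2) z.1.
have mb t i : 0 <= t -> measurable_fun setT (fun w => b t w ord0 i).
  move=> t0; have -> : (fun w => b t w ord0 i) =
      (fun w => \1_N w * x ord0 i + \1_(~` N) w * B t w ord0 i).
    apply/funext => w; rewrite /b !indicE in_setC.
    by case: (w \in N); rewrite /= ?(mul1r, mul0r, addr0, add0r).
  apply: measurable_funD; apply: measurable_funM => //.
  - by apply: measurable_indic; exact: measurableC.
  - exact: (measurableT_comp (measurable_coord i) (mB t t0)).
have max0_within (t : R) :
    Num.max 0 s @[s --> t] --> within `[0, +oo[ (nbhs (Num.max 0 t)).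
  have cmax : {for t, continuous (fun s : R => Num.max 0 s)}.
    by apply: (@continuous_max R _ (fun=> 0) id); [exact: cst_continuous|exact: cvg_id].
  move=> Q /cmax maxQ; suff : \forall s \near t, Q (Num.max 0 s) by [].
  apply: (@filterS _ (nbhs t) _ _ _ _ maxQ) => s /=; apply.
  by rewrite /= in_itv/= andbT le_max lexx.
have cb w i : continuous (fun t : R => b (Num.max 0 t) w ord0 i).
  move=> t; rewrite /b; case: (boolP (w \in N)) => [_|/negP wN].
    exact: cst_continuous.
  have /goodN[_ /subspace_continuousP cB] : ~ N w by move=> /mem_set.
  apply: (cvg_comp (fun t : R => B (Num.max 0 t) w) (fun y : E => y ord0 i));
    last exact: coord_continuous.
  have t0 : [set` `[0, +oo[] (Num.max 0 t) by rewrite /= in_itv/= andbT le_max lexx.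
  exact: (cvg_comp _ _ (max0_within t) (cB _ t0)).
have mbeta : measurable_fun setT beta.
  apply: measurable_rV => i.
  apply: (continuous_paths_jointly_measurable (b := fun t w => b t w ord0 i)).
    by move=> t; exact: mb.
  by move=> w; exact: cb.
have betaE w t : ~ N w -> 0 <= t -> beta (w, t) = B t w.
  by move=> nNw t0; rewrite /beta /b /= memNset// max_r.
exists N, (MeasurableFun.Pack (MeasurableFun.Class
  (isMeasurableFun.Build _ _ _ _ beta mbeta))).
split=> //= t A t1 mA.
have t0 : 0 < t by exact: lt_le_trans t1.
pose A' := (fun y : E => y + x) @^-1` A.
have mA' : measurable A'.
  rewrite -[X in measurable X]setTI; apply: continuous_measurable_rV => // y.
  by apply: (@continuousD _ _ _ id (cst x)); [exact: cvg_id|exact: cst_continuous].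
have minc : measurable (increment B 0 t @^-1` A').
  rewrite -[X in measurable X]setTI; apply: measurable_rV => // i.
  rewrite (_ : (fun w => _) = (fun w => B t w ord0 i - B 0 w ord0 i)); last first.
    by apply/funext => w; rewrite !mxE.
  by apply: measurable_funB;
    apply: (measurableT_comp (measurable_coord i)); apply: mB; rewrite // ltW.
have mbt : measurable ((fun w => beta (w, t)) @^-1` A).
  rewrite -[X in measurable X]setTI.
  exact: (measurableT_comp mbeta (pair2_measurable (t : RT))).
apply: (@le_trans _ _ (P (increment B 0 t @^-1` A' `|` N))).
  apply: le_measure; rewrite ?inE//; first exact: measurableU.
  move=> w /= Abt; have [Nw|nNw] := pselect (N w); [by right|left].
  rewrite /increment /A' /= (goodN w nNw).1 subrK.
  by rewrite -betaE// ltW.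
apply: (le_trans (measureU2 _ minc mN)).
rewrite [X in (_ + X <= _)%E](_ : _ = 0%E) ?adde0; last exact: PN.
have /eqP := law 0 t A' (lexx 0) t0 mA'; rewrite subr0 eq_le => /andP[+ _].
move=> /le_trans; apply.
apply: (@le_trans _ _ (\int[lebesgue_rV R d]_(y in A') (decay t)%:E)%E).
  apply: ge0_le_integral => //.
  - by move=> y _; rewrite lee_fin heat_kernel_ge0.
  - by apply/measurable_EFinP; apply: measurable_funTS; exact: measurable_heat_kernel.
  - by move=> y _; rewrite lee_fin heat_kernel_le_decay.
rewrite integral_cst// le_eqVlt; apply/orP; left; apply/eqP; congr (_ * _)%E.
exact: lebesgue_rV_shift.
Qed.

End brownian_occupation.

(** * Representation of the improper time integral *)

Theorem theorem8 (R : realType) (d : nat) (d_ge3 : (3 <= d)%N)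
  (x : 'rV[R]_d) (disp : measure_display) (Omega : measurableType disp)
  (P : probability Omega R) (B : R -> Omega -> 'rV[R]_d)
  (B_brownian : brownian_motion P B x) :
  exists Y : CL R d -> L1 P,
    [/\ forall f : CL R d, is_improper_time_integral B f (Y f),
        linear Y,
        continuous Y &
        exists mu : set 'rV[R]_d -> L1 P,
          [/\ vsigma_additive mu,
              forall f : CL R d, is_vintegral_space mu f (Y f) &
              forall nu : set 'rV[R]_d -> L1 P,
                vsigma_additive nu ->
                (forall f : CL R d, is_vintegral_space nu f (Y f)) ->
                forall A, bounded_borel A -> nu A = mu A]].
Proof.
have [N [beta [mN PN betaE law]]] :=
  brownian_jointly_measurable_version d_ge3 B_brownian.
pose halfl : set (measurableTypeR R) := `[0, +oo[%classic.
have mhalfl : measurable halfl by exact: measurable_itv.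
pose G := occupation_measure P beta.
pose J := occupation_operator P beta halfl.
have intG (f : CL R d) : G.-integrable setT (EFin \o f).
  exact: CL_occupation_integrable.
have J_linear (a : R) (f g : 'rV[R]_d -> R) :
    G.-integrable setT (EFin \o f) -> G.-integrable setT (EFin \o g) ->
    J (fun y => a * f y + g y) = a *: J f + J g.
  by apply: occupation_operator_linear.
have le_normr_J (f : 'rV[R]_d -> R) : G.-integrable setT (EFin \o f) ->
    `|J f| <= \int[G]_y `|f y|.
  exact: le_normr_occupation_operator.
have G_fin (A : set 'rV[R]_d) : bounded_borel A -> (G A < +oo)%E.
  exact: occupation_bounded_borel.
have mCL (f : CL R d) : measurable_fun setT f.
  by apply: continuous_measurable_mx; exact: CL_continuous.
exists (fun f : CL R d => J f); split.
- move=> f; exists (fun T => occupation_operator P beta `[0, T] f).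
    move=> T T0.
    have m0T : measurable (`[0, T] : set (measurableTypeR R)).
      exact: measurable_itv.
    have sub0T : (`[0, T] : set (measurableTypeR R)) `<=` halfl.
      by move=> t; rewrite /halfl /= !in_itv/= => /andP[->].
    have aeN : {ae P, forall w, ~ N w}.
      by exists N; split=> // w /= /contrapT.
    have := fiber_integralE (integrable_occupation m0T sub0T (intG f)).
    apply: filterS2 aeN => w nNw /(_ Logic.I) ->.
    rewrite /time_integral [RHS]Rintegral_mkcond; apply: eq_Rintegral => t _.
    rewrite /= patch_indic /= !indicE !mem_setE in_itv/=.
    have [t0|t0] := leP 0 t; last by rewrite !mulr0.
    by rewrite betaE.
  (* the error at time T is at most 2 I / sqrt T *)
  pose I := \int[lebesgue_rV R d]_y `|f y|.
  have cvgI : 2 * (Num.sqrt T)^-1 * I @[T --> +oo] --> (0 : R).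
    rewrite -[0](mul0r I) -[in X in X * I](mulr0 2).
    by apply: cvgMl; apply: cvgMr; exact: cvg_invr_sqrt_pinfty.
  apply/cvgrPdist_lt => e e0.
  move/cvgrPdist_lt : cvgI => /(_ _ e0) cvgI.
  near=> T; have T1 : 1 <= T by near: T; exact: nbhs_pinfty_ge.
  apply: le_lt_trans (_ : 2 * (Num.sqrt T)^-1 * I < e).
    exact: (occupation_operator_tail law T1 (intG f) (CL_integrable f)).
  have : `|0 - 2 * (Num.sqrt T)^-1 * I| < e by near: T.
  by rewrite sub0r normrN; apply: le_lt_trans; exact: ler_norm.
- by move=> a f g; exact: (J_linear a f g (intG f) (intG g)).
- move=> f; apply/(@cvgrPdist_lt _ _ _ (nbhs f)) => e e0.
  have e20 : 0 < e / 2 by rewrite divr_gt0.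
  have : nbhs f (ball f (e / 2)) by exact: nbhsx_ballx.
  apply: filterS => g; rewrite -ball_normE /= => fg.
  have -> : J f - J g = J (f - g : CL R d).
    have <- : -1 *: g + f = f - g by rewrite scaleN1r addrC.
    by rewrite (J_linear (-1) g f (intG g) (intG f)) scaleN1r addrC.
  apply: le_lt_trans (le_normr_occupation_CL law (f - g)) _.
  by rewrite mulrC -ltr_pdivlMr.
- exists (operator_measure J); split.
  + exact: (operator_measure_sigma_additive J_linear le_normr_J G_fin).
  + move=> f.
    exact: (is_vintegral_space_operator_measure J_linear le_normr_J G_fin).
  + move=> nu nu_sa nuY A bA; apply: L1_vector_measure_unique => //.
      exact: (operator_measure_sigma_additive J_linear le_normr_J G_fin).
    move=> f; exists (J f) => //.
    exact: (is_vintegral_space_operator_measure J_linear le_normr_J G_fin).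
Unshelve. all: by end_near. Qed.
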